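(* Let $m\ge0$ be an integer and $R=\mathbf{F}_3[x_1,x_2,x_3]^{S_3}$. Then $Q_m(3,\mathbf{F}_3)_{\mathrm{sign-triv}}$ is, as an $R$-module, either freely generated by a generator of degree $3m+1$, a generator of degree $3m+2$, and the polynomial $1$; or ($m\in X$ and) freely generated by $R_m$, another generator of degree $6m+3-\deg R_m$, and the polynomial $1$.
   Context: $S_3$ acts on $\mathbf{F}_3[x_1,x_2,x_3]$ by permuting variables; $s_{ij}$ is the transposition of $x_i,x_j$. For a field $\Bbbk$ and integer $m\ge0$, $Q_m(3,\Bbbk)$ is the space of all $K\in\Bbbk[x_1,x_2,x_3]$ such that $(x_i-x_j)^{2m+1}$ divides $(1-s_{ij})K$ for all $1\le i<j\le3$. Over $\mathbf{F}_3$, $\mathrm{triv}$ and $\mathrm{sign}$ are the one-dimensional representations of $S_3$, and $\mathrm{sign-triv}$ is the $2$-dimensional indecomposable representation containing a copy of $\mathrm{triv}$ with quotient $\mathrm{sign}$. $Q_m(3,\mathbf{F}_3)_{\mathrm{sign-triv}}$ is the sum of all subrepresentations of $Q_m(3,\mathbf{F}_3)$ isomorphic to $\mathrm{sign}$, $\mathrm{triv}$ or $\mathrm{sign-triv}$; it is an $R$-module. A generator of it is a homogeneous polynomial, other than $1$ and $\prod_{i<j}(x_i-x_j)^{2m+1}$, lying in the $(-1)$-eigenspace of $s_{12}$ and belonging to a homogeneous generating set of this $R$-module with the least possible number of elements. ''Freely generated by'' a set means the set is an $R$-basis. For an integer $k\ge0$ let $\overline{P_k}$ be the generator of $Q_k(3,\mathbf{Q})$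 (as a $\mathbf{Q}[x_1,x_2,x_3]^{S_3}$-module) of degree $3k+1$ in the $(-1)$-eigenspace of $s_{12}$, scaled to have coprime integer coefficients (unique up to sign), and $P_k\in\mathbf{F}_3[x_1,x_2,x_3]$ its reduction mod $3$. A Ren--Xu counterexample in $Q_m(3,\mathbf{F}_3)$ is a polynomial $P_k^{3^a}\prod_{i<j}(x_i-x_j)^{2b}$ with integers $a,b,k\ge0$ that lies in $Q_m(3,\mathbf{F}_3)$ and has degree strictly less than $3m+1$. $X$ is the set of integers $m\ge0$ such that $Q_m(3,\mathbf{F}_3)$ contains a Ren--Xu counterexample, and for $m\in X$, $R_m$ denotes a (fixed) Ren--Xu counterexample of lowest degree in $Q_m(3,\mathbf{F}_3)$. *)

(* Defs.v *)
From mathcomp Require Import all_boot all_order all_algebra all_fingroup.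
From mathcomp Require Import mxrepresentation.
From mathcomp Require Import mpoly.

Set Implicit Arguments.
Unset Strict Implicit.
Unset Printing Implicit Defensive.

Import GRing.Theory.
Local Open Scope ring_scope.

(* Total degree; the zero polynomial gets degree 0. *)
Definition degree (k : nzRingType) (p : {mpoly k[3]}) : nat := (msize p).-1.

Definition is_homogeneous (k : nzRingType) (p : {mpoly k[3]}) : Prop :=
  exists d : nat, p \is d.-homog.

(* Variables are indexed from 0, so this swaps x_1 and x_2. *)
Definition s12 : 'S_3 := tperm (0 : 'I_3) (1 : 'I_3).

Definition in_minus_eigenspace (k : nzRingType) (p : {mpoly k[3]}) : Prop :=
  msym s12 p = - p.

Definition quasi_invariant (k : fieldType) (m : nat) (K : {mpoly k[3]}) : Prop :=
  forall i j : 'I_3, (i < j)%N ->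
  exists q : {mpoly k[3]},
    K - msym (tperm i j) K = q * ('X_i - 'X_j) ^+ (2 * m + 1).

Definition diff_prod (k : fieldType) (e : nat) : {mpoly k[3]} :=
  \prod_(ij : 'I_3 * 'I_3 | (ij.1 < ij.2)%N) ('X_(ij.1) - 'X_(ij.2)) ^+ e.

(* Modules over the ring of symmetric polynomials, as subsets M of the
   polynomial ring. *)

Definition sym_comb (k : fieldType) (S : seq {mpoly k[3]})
    (r : 'I_(size S) -> {mpoly k[3]}) : {mpoly k[3]} :=
  \sum_(i < size S) r i * S`_i.

(* M is exactly the span of S; in particular M is then a submodule. *)
Definition generates (k : fieldType) (M : {mpoly k[3]} -> Prop)
    (S : seq {mpoly k[3]}) : Prop :=
  forall p, M p <->
    exists r : 'I_(size S) -> {mpoly k[3]},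
      (forall i, r i \is @symmetric 3 k) /\ p = sym_comb r.

Definition freely_generates (k : fieldType) (M : {mpoly k[3]} -> Prop)
    (S : seq {mpoly k[3]}) : Prop :=
  generates M S /\
  forall r : 'I_(size S) -> {mpoly k[3]},
    (forall i, r i \is @symmetric 3 k) -> sym_comb r = 0 -> forall i, r i = 0.

Definition homogeneous_generating (k : fieldType) (M : {mpoly k[3]} -> Prop)
    (S : seq {mpoly k[3]}) : Prop :=
  generates M S /\ forall g, g \in S -> is_homogeneous g.

Definition minimal_generator (k : fieldType) (M : {mpoly k[3]} -> Prop)
    (g : {mpoly k[3]}) : Prop :=
  exists S : seq {mpoly k[3]},
    [/\ homogeneous_generating M S,
        (forall T, homogeneous_generating M T -> (size S <= size T)%N)
      & g \in S].

(* Representations of S_3 over F_3.  MathComp representations act on row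
   vectors on the right, as does msym: msym (s * t) p = msym t (msym s p). *)

Section Representations.
Variables (n : nat) (rG : mx_representation 'F_3 [set: 'S_3]%G n).

Definition is_triv : Prop := n = 1%N /\ forall s, rG s = 1%:M.

Definition is_sign : Prop := n = 1%N /\ forall s : 'S_3, rG s = ((-1) ^+ s)%:M.

Definition indecomposable : Prop :=
  n <> 0%N /\
  forall U V : 'M['F_3]_n, mxmodule rG U -> mxmodule rG V ->
    (U + V == 1%:M)%MS -> (U :&: V)%MS = 0 -> U = 0 \/ V = 0.

(* W is a subrepresentation of the polynomial ring isomorphic to rG *)
Definition subrep_iso (W : {mpoly 'F_3[3]} -> Prop) : Prop :=
  exists phi : {linear 'rV['F_3]_n -> {mpoly 'F_3[3]}},
    [/\ injective phi,
        (forall (s : 'S_3) v, phi (v *m rG s) = msym s (phi v))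
      & forall p, W p <-> exists v, p = phi v].

End Representations.

Definition is_sign_triv (n : nat)
    (rG : mx_representation 'F_3 [set: 'S_3]%G n) : Prop :=
  [/\ n = 2%N, indecomposable rG
    & exists (U : 'M['F_3]_n) (Umod : mxmodule rG U),
        is_triv (submod_repr Umod) /\ is_sign (factmod_repr Umod)].

Definition sign_triv_subrep (m : nat) (W : {mpoly 'F_3[3]} -> Prop) : Prop :=
  (forall p, W p -> quasi_invariant m p) /\
  exists (n : nat) (rG : mx_representation 'F_3 [set: 'S_3]%G n),
    [\/ is_sign rG, is_triv rG | is_sign_triv rG] /\ subrep_iso rG W.

(* The sum of all these subrepresentations: finite sums of their elements. *)
Definition Q_sign_triv (m : nat) (p : {mpoly 'F_3[3]}) : Prop :=
  exists s : seq {mpoly 'F_3[3]},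
    p = \sum_(w <- s) w /\
    forall w, w \in s -> exists W, sign_triv_subrep m W /\ W w.

Definition generator (m : nat) (g : {mpoly 'F_3[3]}) : Prop :=
  [/\ minimal_generator (Q_sign_triv m) g, in_minus_eigenspace g,
      g <> 1 & g <> diff_prod 'F_3 (2 * m + 1)].

Definition primitive_coefs (P : {mpoly int[3]}) : Prop :=
  forall d : int, (forall mon, (d %| P@_mon)%Z) -> `|d|%N = 1%N.

(* Determined by k up to sign. *)
Definition is_Pbar (k : nat) (P : {mpoly int[3]}) : Prop :=
  let PQ : {mpoly rat[3]} := map_mpoly intr P in
  [/\ minimal_generator (@quasi_invariant rat k) PQ,
      degree PQ = (3 * k + 1)%N, in_minus_eigenspace PQ & primitive_coefs P].

Definition is_P (k : nat) (P : {mpoly 'F_3[3]}) : Prop :=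
  exists Pbar : {mpoly int[3]}, is_Pbar k Pbar /\ P = map_mpoly intr Pbar.

Definition ren_xu_counterexample (m : nat) (F : {mpoly 'F_3[3]}) : Prop :=
  [/\ exists (a b k : nat) (P : {mpoly 'F_3[3]}),
        is_P k P /\ F = P ^+ (3 ^ a) * diff_prod 'F_3 (2 * b),
      quasi_invariant m F
    & (degree F < 3 * m + 1)%N].

Definition in_X (m : nat) : Prop := exists F, ren_xu_counterexample m F.

Definition lowest_counterexample (m : nat) (F : {mpoly 'F_3[3]}) : Prop :=
  ren_xu_counterexample m F /\
  forall F', ren_xu_counterexample m F' -> (degree F <= degree F')%N.

(* Main.v *)
From HB Require Import structures.
Require Import Defs.
From mathcomp Require Import all_boot all_order all_algebra all_fingroup.
From mathcomp Require Import finfield mxrepresentation.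
From mathcomp Require Import mpoly ring zify.
Set Implicit Arguments.
Unset Strict Implicit.
Unset Printing Implicit Defensive.
Import GRing.Theory.
Local Open Scope ring_scope.

(** Let $n = 2m+1$. Both $\mathrm{sign}$ and $\mathrm{sign\text{-}triv}$ have a vector on which
    $s_{12}$ acts by $-1$ and whose sum over the 3-cycles vanishes. Accordingly the module in question
    is $T \oplus R$ (Q_sign_trivP), where $T$ consists of the $f$ with $s_{12}f = -f$, zero trace under
    the 3-cycle $c$, and $(x_1-x_2)^n \mid f$ (the predicate twisted). So everything is about the
    rank-two module $T$.

    For $f, g \in T$ the wronskian $W(f,g) = f\cdot cg - g\cdot cf$ is antisymmetric and divisible by
    $(x_1-x_2)^n$, hence by $\prod_{i<j}(x_i-x_j)^n$. If $W(f,g) \ne 0$ then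
    $\deg f + \deg g \ge 3n = 6m+3$ (wronsk_degree), and if equality holds then $f, g$ is a basis of $T$
    by Cramer's rule (saito). So it is enough to find $f, q \in T$ of degrees summing to $6m+3$ with
    nonzero wronskian, and to find out what these degrees can be.

    In characteristic 3 the elementary symmetric polynomial $e_1$ is translation invariant, so the
    translation-invariant polynomials are those in $X = x_1-x_2$ and $e_1$; setting $e_1 = 1$ turns $c$
    into $X \mapsto X-1$, and $T$ into the odd $F \in \mathbf{F}_3[X]$ with $F(X)+F(X-1)+F(X-2)=0$ and
    $X^n \mid F$ (odd_traceless). An induction on $m$ (odd_traceless_basis) gives two such $F, G$ with
    degrees summing to at most $6m+4$. One degree is saved by leaving the translation-invariant world:
    the degrees are odd and $(x_1-x_2)^2 \equiv -e_2$ modulo $e_1$, so a symmetric combination of the two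
    homogenizations is divisible by $e_1$, and the quotient $q$ is again in $T$ (twisted_basis). With
    $f$ the homogenization of $F$, the degrees $d_1$ of $f$ and $d_2$ of $q$ satisfy $d_1 + d_2 = 6m+3$
    and $d_1 \le d_2+1$.

    If $d_1 > 3m$, then $\{d_1,d_2\} = \{3m+1,3m+2\}$. If $d_1 \le 3m$, then $F$ has too small a degree for
    the wronskian of $F$ and $F'$, which vanishes to order $2m$ on the mirrors, to be nonzero; hence
    $F$ is a shift-invariant polynomial times a cube (odd_traceless_cube). Extracting cubes and factors
    $(X^3-X)^2$ repeatedly (odd_traceless_descent) produces $l,a,b$ such that
    $P_l^{3^a}\prod_{i<j}(x_i-x_j)^{2b}$ lies in $T$ and has degree at most $d_1$: it is a Ren--Xu
    counterexample. A lowest counterexample $R_m$ has degree at most $d_1 \le 3m$, so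
    $W(R_m,f) = 0$ by degree; then $W(R_m,q) \ne 0$, which forces $\deg R_m = d_1$ and makes $R_m, q$ a basis.

    The descent needs to know that $P_l$ exists and reduces to an element of $T$ for $m = l$. Over
    $\mathbf{Q}$ the integrals $\int_{x_1}^{x_2} t^j\prod_i (t-x_i)^l\,dt$ for $j = 0, 1$ satisfy the same
    criterion, which yields a basis of $Q_l(3,\mathbf{Q})$ over the symmetric polynomials, with an element
    of degree $3l+1$ (six_generators_free, is_P_exists); the divisibility and trace conditions survive
    clearing of denominators and reduction (is_P_twisted). *)

Local Notation i0 := (0 : 'I_3).
Local Notation i1 := (1 : 'I_3).
Local Notation i2 := (@Ordinal 3 2 isT).

(** * Divisibility by a difference of two variables *)

Section Collapse.
Variables (R : comNzRingType) (n : nat).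

(** Restriction to the mirror $x_i = x_j$. *)
Definition collapse (i j : 'I_n) (p : {mpoly R[n]}) : {mpoly R[n]} :=
  p \mPo [tuple (if k == i then 'X_j else 'X_k) | k < n].

Lemma collapseX i j k : collapse i j 'X_k = if k == i then 'X_j else 'X_k.
Proof. by rewrite /collapse comp_mpolyXU -tnth_nth tnth_mktuple. Qed.

Lemma collapseM i j : {morph collapse i j : p q / p * q}.
Proof. by move=> p q; rewrite /collapse rmorphM. Qed.

Lemma collapseB i j : {morph collapse i j : p q / p - q}.
Proof. by move=> p q; rewrite /collapse rmorphB. Qed.

Lemma collapseXn i j e : {morph collapse i j : p / p ^+ e}.
Proof. by move=> p; rewrite /collapse rmorphXn. Qed.

Lemma collapse_factor (i j : 'I_n) p :
  exists q, p - collapse i j p = q * ('X_i - 'X_j).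
Proof.
rewrite /collapse; set t := [tuple _ | _ < _].
elim/mpolyind: p => [|c m p _ _ [q hq]].
  by exists 0; rewrite comp_mpoly0 subr0 mul0r.
suff [r hr] : exists r, 'X_[m] - ('X_[m] \mPo t) = r * ('X_i - 'X_j).
  exists (c *: r + q).
  by rewrite comp_mpolyD comp_mpolyZ opprD addrACA -scalerBr hr hq mulrDl scalerAl.
rewrite comp_mpolyX mpolyXE_id.
apply: (big_ind2 (fun a b => exists r, a - b = r * ('X_i - 'X_j))).
- by exists 0; rewrite subrr mul0r.
- move=> a b a' b' [r hr] [r' hr']; exists (r * a' + b * r').
  have -> : a * a' - b * b' = (a - b) * a' + b * (a' - b') by ring.
  by rewrite hr hr'; ring.
move=> k _; rewrite tnth_mktuple.
case: (k == i) / eqP => [->|_]; last by exists 0; rewrite subrr mul0r.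
by rewrite subrXX mulrC; eexists.
Qed.
End Collapse.

(** The factor theorem for the mirror $x_i = x_j$: a polynomial and its restriction are congruent
    modulo $x_i - x_j$. *)
Lemma collapse_eq0 (R : comNzRingType) n (i j : 'I_n) (p : {mpoly R[n]}) :
  i != j -> collapse i j p = 0 <-> exists q, p = q * ('X_i - 'X_j).
Proof.
move=> nij; split=> [h|[q ->]].
  by have [q hq] := collapse_factor i j p; exists q; rewrite -hq h subr0.
by rewrite collapseM collapseB !collapseX eqxx eq_sym (negPf nij) subrr mulr0.
Qed.

(** * The action of $S_3$ and the Vandermonde polynomial *)

Lemma mpolyX_sub_neq0 (R : nzRingType) n (i j : 'I_n) :
  i != j -> 'X_i - 'X_j != 0 :> {mpoly R[n]}.
Proof.
move=> nij; apply: contra_neq nij => /eqP; rewrite subr_eq0 => /eqP /(congr1 (mcoeff U_(i)%MM)).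
by rewrite !mcoeffXU eqxx; case: eqP => // _ /eqP; rewrite oner_eq0.
Qed.

(** The ideal of the mirror is prime, so powers of its equation can be cancelled against any factor
    $u$ that does not vanish identically on it. *)
Lemma pow_dvd_cancel (k : idomainType) n (i j : 'I_n) (u a b : {mpoly k[n]}) e :
  i != j -> collapse i j u != 0 -> a * u = b * ('X_i - 'X_j) ^+ e ->
  exists a', a = a' * ('X_i - 'X_j) ^+ e.
Proof.
move=> nij nu; elim: e a b => [|e IH] a b; first by move=> _; exists a; rewrite mulr1.
move=> hab.
have /(collapse_eq0 _ nij) [a1 ha1] : collapse i j a = 0.
  apply: (mulIf nu); rewrite -collapseM hab exprS !collapseM collapseB !collapseX.
  by rewrite eqxx eq_sym (negPf nij) subrr !mul0r mulr0.
have nl := @mpolyX_sub_neq0 k n i j nij.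
have [a' ha'] : exists a', a1 = a' * ('X_i - 'X_j) ^+ e.
  apply: (IH _ b); apply: (mulIf nl).
  by rewrite mulrAC -ha1 hab exprSr mulrA.
by exists a'; rewrite ha1 ha' exprSr mulrA.
Qed.

Lemma msymXU n (R : nzRingType) (s : 'S_n) i : msym s 'X_i = 'X_(s i) :> {mpoly R[n]}.
Proof.
rewrite msymX; congr mpolyX; apply/mnmP => j.
by rewrite mnmE !mnm1E -(inj_eq (@perm_inj _ s) i) permKV.
Qed.

(** The 3-cycle $x_1 \to x_2 \to x_3 \to x_1$. *)
Definition c3 : 'S_3 := perm (@ordS_inj 3).

Lemma I3P (i : 'I_3) : [\/ i = i0, i = i1 | i = i2].
Proof.
case: i => [[|[|[|m]]] hi]; last by [].
- by constructor 1; apply/val_inj.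
- by constructor 2; apply/val_inj.
- by constructor 3; apply/val_inj.
Qed.

Lemma s12E : (s12 i0 = i1) * (s12 i1 = i0) * (s12 i2 = i2).
Proof. by rewrite /s12 tpermL tpermR tpermD. Qed.

Lemma c3E : (c3 i0 = i1) * (c3 i1 = i2) * (c3 i2 = i0).
Proof.
by rewrite !permE; do !split; apply/val_inj.
Qed.

Lemma c3_cubed : (c3 * c3 * c3 = 1)%g.
Proof. by apply/permP => i; rewrite !permM perm1; case: (I3P i) => ->; rewrite !c3E. Qed.

Lemma c3_s12 : (c3 * s12 = s12 * c3 * c3)%g.
Proof. by apply/permP => i; rewrite !permM; case: (I3P i) => ->; rewrite !(c3E, s12E). Qed.

Lemma s12_invol : (s12 * s12 = 1)%g.
Proof. exact: tperm2. Qed.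

Lemma tperm3E : (tperm i0 i2 = s12 * c3)%g /\ (tperm i1 i2 = s12 * c3 * c3)%g.
Proof.
split; apply/permP => i; rewrite !permM; case: (I3P i) => ->;
by rewrite !(c3E, s12E) ?(tpermL, tpermR, tpermD).
Qed.

(** $S_3$ is generated by $s_{12}$ and the 3-cycle, so invariance properties need to be checked on
    these two elements only. *)
Lemma S3_ind (P : 'S_3 -> Prop) :
  P s12 -> P c3 -> P 1%g -> (forall s t, P s -> P t -> P (s * t)%g) -> forall s, P s.
Proof.
move=> P12 Pc P1 PM s; have [ts -> _] := prod_tpermP s.
elim/big_ind: _ => // [[i j]] _ /=.
have [t02 t12] := tperm3E.
have H02 : P (tperm i0 i2) by rewrite t02; apply: PM.
have H12 : P (tperm i1 i2) by rewrite t12; exact: PM (PM _ _ P12 Pc) Pc.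
by case: (I3P i) => ->; case: (I3P j) => ->; rewrite ?tperm1 // tpermC.
Qed.

(** Locked, like the other operations on polynomials below, so that comparing two expressions never
    evaluates them. *)
HB.lock Definition cyc (k : idomainType) (f : {mpoly k[3]}) := msym c3 f.

HB.lock Definition vdm (k : idomainType) : {mpoly k[3]} :=
  ('X_i0 - 'X_i1) * ('X_i0 - 'X_i2) * ('X_i1 - 'X_i2).

Section Action.
Variable k : idomainType.
Implicit Types f g p : {mpoly k[3]}.

Local Notation cyc := (@cyc k).
Lemma cycE f : cyc f = msym c3 f. Proof. by rewrite cyc.unlock. Qed.
Lemma cyc0 : cyc 0 = 0. Proof. by rewrite cycE msym0. Qed.
Lemma cycM : {morph cyc : f g / f * g}. Proof. by move=> f g; rewrite !cycE msymM. Qed.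
Lemma cycD : {morph cyc : f g / f + g}. Proof. by move=> f g; rewrite !cycE msymD. Qed.
Lemma cycN : {morph cyc : f / - f}. Proof. by move=> f; rewrite !cycE msymN. Qed.
Lemma cycB : {morph cyc : f g / f - g}. Proof. by move=> f g; rewrite !cycE msymB. Qed.
Lemma cycXn n : {morph cyc : f / f ^+ n}. Proof. by move=> f; rewrite !cycE rmorphXn. Qed.
Lemma cyc3 f : cyc (cyc (cyc f)) = f.
Proof. by rewrite !cycE -!msymMm mulgA c3_cubed msym1m. Qed.
Lemma s12_cyc f : msym s12 (cyc f) = cyc (cyc (msym s12 f)).
Proof. by rewrite !cycE -!msymMm c3_s12 -mulgA. Qed.
Lemma s12K f : msym s12 (msym s12 f) = f.
Proof. by rewrite -msymMm s12_invol msym1m. Qed.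

Lemma symmetricP f : f \is symmetric <-> msym s12 f = f /\ cyc f = f.
Proof.
split=> [/issymP h|[h1 h2]]; first by rewrite cycE; split; apply: h.
apply/issymP; elim/S3_ind => //; [by rewrite -cycE|exact: msym1m|].
by move=> s t hs ht; rewrite msymMm hs ht.
Qed.

Definition y12 : {mpoly k[3]} := 'X_i0 - 'X_i1.
Local Notation vdm := (vdm k).
Lemma vdmE : vdm = ('X_i0 - 'X_i1) * ('X_i0 - 'X_i2) * ('X_i1 - 'X_i2).
Proof. by rewrite vdm.unlock. Qed.

Lemma cyc_X : (cyc 'X_i0 = 'X_i1) * (cyc 'X_i1 = 'X_i2) * (cyc 'X_i2 = 'X_i0).
Proof. by rewrite !cycE !msymXU !c3E. Qed.
Lemma s12_X : (msym s12 'X_i0 = 'X_i1 :> {mpoly k[3]}) * (msym s12 'X_i1 = 'X_i0 :> {mpoly k[3]})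
   * (msym s12 'X_i2 = 'X_i2 :> {mpoly k[3]}).
Proof. by rewrite !msymXU !s12E. Qed.

Lemma s12_y12 : msym s12 y12 = - y12.
Proof. by rewrite /y12 msymB !s12_X opprB. Qed.
Lemma cyc_y12 : cyc y12 = 'X_i1 - 'X_i2.
Proof. by rewrite /y12 cycB !cyc_X. Qed.
Lemma s12_vdm : msym s12 vdm = - vdm.
Proof. by rewrite vdmE !(msymM, msymB) !s12_X; ring. Qed.
Lemma cyc_vdm : cyc vdm = vdm.
Proof. by rewrite vdmE !(cycM, cycB) !cyc_X; ring. Qed.
Lemma X_neq (i j : 'I_3) : i != j -> 'X_i - 'X_j != 0 :> {mpoly k[3]}.
Proof. exact: mpolyX_sub_neq0. Qed.
Lemma vdm_neq0 : vdm != 0. Proof. by rewrite vdmE !mulf_neq0 ?X_neq. Qed.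
Lemma y12_dhomog : y12 \is 1.-homog.
Proof. by rewrite /y12 rpredB // dhomogX /= mdeg1. Qed.
Lemma vdm_dhomog : vdm \is 3.-homog.
Proof.
have h (i j : 'I_3) : ('X_i - 'X_j : {mpoly k[3]}) \is 1.-homog.
  by rewrite rpredB // dhomogX /= mdeg1.
rewrite vdmE; exact: dhomogM (dhomogM (h _ _) (h _ _)) (h _ _).
Qed.

(** The conjugates of $x_1-x_2$ are pairwise non-associate primes, so divisibility by the $n$-th
    power of one gives divisibility by that of their product; the quotient is symmetric because for
    odd $n$ both sides change sign under $s_{12}$. *)
Lemma antisym_dvd n f q : odd n -> msym s12 f = - f -> cyc f = f ->
  f = q * y12 ^+ n -> exists2 r, r \is symmetric & f = r * vdm ^+ n.
Proof.
move=> on s12f cycf fq.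
suff [r fr] : exists r, f = r * vdm ^+ n.
  exists r => //; have n0 : vdm ^+ n != 0 by rewrite expf_neq0 // vdm_neq0.
  apply/symmetricP; split; apply: (mulIf n0); rewrite -fr.
    move: s12f; rewrite fr msymM rmorphXn /= s12_vdm exprNn -signr_odd on expr1 mulN1r mulrN.
    by move/oppr_inj ->.
  by move: cycf; rewrite fr cycM cycXn cyc_vdm => ->.
have f2 : f = cyc q * ('X_i1 - 'X_i2) ^+ n by rewrite -cycf fq cycM cycXn cyc_y12.
have f3 : f = cyc (cyc q) * (-1) ^+ n * ('X_i0 - 'X_i2) ^+ n.
  rewrite -mulrA -exprNn opprB -cycf f2 cycM cycXn cycB !cyc_X //.
(* The other two mirrors: $c$ carries the given divisor to $x_2-x_3$ and $x_3-x_1$. *)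
have [||q' hq'] := @pow_dvd_cancel k 3 i1 i2 (y12 ^+ n) q (cyc q) n _ _ (etrans (esym fq) f2) => //.
  by rewrite collapseXn expf_neq0 // /y12 collapseB !collapseX /= X_neq.
have := etrans (esym fq) f3; rewrite hq' -mulrA => H.
have [||q'' hq''] := @pow_dvd_cancel k 3 i0 i2 _ _ _ n _ _ H => //.
  rewrite collapseM !collapseXn mulf_neq0 ?expf_neq0 //.
    by rewrite collapseB !collapseX /= X_neq.
  by rewrite /y12 collapseB !collapseX /= X_neq.
exists q''; rewrite fq hq' hq'' vdmE /y12 !exprMn; ring.
Qed.
End Action.

(** * Twisted polynomials and the wronskian criterion *)

(** The ring tactic, with the operations that it need not look into turned into variables. *)
Ltac mring :=
  repeat match goal with
  | |- context [?c *: ?f] => generalize (c *: f); intro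
  | |- context [@msym ?n ?R ?s ?f] => generalize (@msym n R s f); intro
  | |- context [@cyc ?k ?f] => generalize (@cyc k f); intro
  | |- context [@vdm ?k] => generalize (@vdm k); intro
  | |- context [@y12 ?k] => generalize (@y12 k); intro
  | |- context [@mpolyX ?n ?R ?f] => generalize (@mpolyX n R f); intro
  end; ring.

Lemma dhomog_msizeE (R : idomainType) n d (p : {mpoly R[n]}) :
  p != 0 -> p \is d.-homog -> msize p = d.+1.
Proof.
move=> p0 hp; rewrite (dhomog_uniq p0 hp (dhomog_msize hp)) prednK //.
by rewrite lt0n msize_poly_eq0.
Qed.

Section Twisted.
Variable k : fieldType.
Implicit Types f g h p : {mpoly k[3]}.

(** Nonzero elements generate a copy of sign or of the two-dimensional representation and lie in its
    $(-1)$-eigenspace for $s_{12}$; the divisibility is the one that quasi-invariance imposes. *)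
Definition twisted n f :=
  [/\ msym s12 f = - f, f + cyc f + cyc (cyc f) = 0
    & exists q, f = q * (y12 k) ^+ n].

(** Only two of the three conjugates under the 3-cycle enter, since trace zero determines the third;
    for twisted arguments this determinant is antisymmetric. *)
Definition wronsk f g := f * cyc g - g * cyc f.

Lemma twisted_cyc2 n f : twisted n f -> cyc (cyc f) = - f - cyc f.
Proof. by case=> _ /eqP h _; move: h; rewrite addrC addr_eq0 opprD => /eqP. Qed.

Lemma twisted_s12_cyc n f : twisted n f -> msym s12 (cyc f) = f + cyc f.
Proof.
move=> tf; have [h _ _] := tf.
by rewrite s12_cyc h !cycN (twisted_cyc2 tf) opprD !opprK.
Qed.

Lemma wronsk_dvd n f g : odd n -> twisted n f -> twisted n g ->
  exists2 r, r \is symmetric & wronsk f g = r * vdm k ^+ n.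
Proof.
move=> on tf tg; have [sf _ [qf hqf]] := tf; have [sg _ [qg hqg]] := tg.
apply: (@antisym_dvd k n _ (qf * cyc g - qg * cyc f)) => //.
- rewrite /wronsk msymB !msymM (twisted_s12_cyc tf) (twisted_s12_cyc tg) sf sg; ring.
- rewrite /wronsk cycB !cycM (twisted_cyc2 tf) (twisted_cyc2 tg); ring.
- by rewrite /wronsk {1}hqf {2}hqg; ring.
Qed.

Lemma cyc_dhomog d f : f \is d.-homog -> cyc f \is d.-homog.
Proof.
by rewrite !homog_piE => /eqP h; rewrite cycE -msym_pihomog h.
Qed.

Lemma wronsk_dhomog d1 d2 f g : f \is d1.-homog -> g \is d2.-homog ->
  wronsk f g \is (d1 + d2).-homog.
Proof.
move=> hf hg; rewrite rpredB ?(dhomogM hf) ?cyc_dhomog // addnC.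
by rewrite (dhomogM hg) // cyc_dhomog.
Qed.

(** A nonzero wronskian is a multiple of a polynomial of degree $3n$. *)
Lemma wronsk_degree n d1 d2 f g : odd n -> twisted n f -> twisted n g ->
  f \is d1.-homog -> g \is d2.-homog -> wronsk f g != 0 ->
  (3 * n <= d1 + d2)%N.
Proof.
move=> on tf tg hf hg w0; have [r _ hr] := wronsk_dvd on tf tg.
have sW := dhomog_msizeE w0 (wronsk_dhomog hf hg).
have r0 : r != 0 by apply: contra_neq w0 => r0; rewrite hr r0 mul0r.
have v0 : vdm k ^+ n != 0 by rewrite expf_neq0 // vdm_neq0.
have sv := dhomog_msizeE v0 (dhomogMn n (vdm_dhomog k)).
move: sW; rewrite hr msizeM // sv; move: r0; rewrite -msize_poly_eq0; lia.
Qed.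

Lemma wronsk_const n d1 d2 f g : odd n -> twisted n f -> twisted n g ->
  f \is d1.-homog -> g \is d2.-homog -> (d1 + d2 = 3 * n)%N -> wronsk f g != 0 ->
  exists2 c, c != 0 & wronsk f g = c *: vdm k ^+ n.
Proof.
move=> on tf tg hf hg ed w0; have [r _ hr] := wronsk_dvd on tf tg.
have sW := dhomog_msizeE w0 (wronsk_dhomog hf hg).
have r0 : r != 0 by apply: contra_neq w0 => r0; rewrite hr r0 mul0r.
have v0 : vdm k ^+ n != 0 by rewrite expf_neq0 // vdm_neq0.
have sv := dhomog_msizeE v0 (dhomogMn n (vdm_dhomog k)).
have /eqP/msize_poly1P [c c0 rc] : msize r = 1%N.
  by move: sW; rewrite hr msizeM // sv; move: r0; rewrite -msize_poly_eq0; lia.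
by exists c => //; rewrite hr rc mul_mpolyC.
Qed.

(** An analogue of Saito's criterion for free arrangements. In Cramer's identity $W(f,g)h = W(h,g)f
    + W(f,h)g$ all three wronskians are symmetric multiples of the $n$-th power of the Vandermonde
    polynomial, and $W(f,g)$ is a constant multiple of it. *)
Lemma saito n d1 d2 f g : odd n -> twisted n f -> twisted n g ->
  f \is d1.-homog -> g \is d2.-homog -> (d1 + d2 = 3 * n)%N -> wronsk f g != 0 ->
  forall h, twisted n h ->
  exists r s, [/\ r \is symmetric, s \is symmetric & h = r * f + s * g].
Proof.
move=> on tf tg hf hg ed w0 h th.
have [c c0 wc] := wronsk_const on tf tg hf hg ed w0.
have [r sr hr] := wronsk_dvd on th tg.
have [s ss hs] := wronsk_dvd on tf th.
exists (c^-1 *: r), (c^-1 *: s); split; try exact: rpredZ.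
have v0 : vdm k ^+ n != 0 by rewrite expf_neq0 // vdm_neq0.
have key : (c *: vdm k ^+ n) * h = (r * vdm k ^+ n) * f + (s * vdm k ^+ n) * g.
  by rewrite -wc -hr -hs /wronsk; ring.
apply: (mulfI v0); apply: (can_inj (scalerK c0)); rewrite scalerAl key.
rewrite mulrDr scalerDr -!scalerAl -!scalerAr !scalerA mulfV // !scale1r; ring.
Qed.

(** Applying the 3-cycle to a relation gives a second one; the two have determinant $W(f,g)$. *)
Lemma wronsk_free f g r s : wronsk f g != 0 -> cyc r = r -> cyc s = s ->
  r * f + s * g = 0 -> r = 0 /\ s = 0.
Proof.
move=> w0 hr hs e.
have e' : r * cyc f + s * cyc g = 0 by rewrite -hr -hs -!cycM -cycD e cyc0.
split; apply: (mulIf w0); rewrite mul0r /wronsk.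
  have -> : r * (f * cyc g - g * cyc f) = cyc g * (r * f + s * g) - g * (r * cyc f + s * cyc g) by ring.
  by rewrite e e' !mulr0 subr0.
have -> : s * (f * cyc g - g * cyc f) = f * (r * cyc f + s * cyc g) - cyc f * (r * f + s * g) by ring.
by rewrite e e' !mulr0 subr0.
Qed.
End Twisted.

(** * Minimal generating sets and quasi-invariants *)

Section Generators.
Variable k : fieldType.
Implicit Types (M : {mpoly k[3]} -> Prop) (S T : seq {mpoly k[3]}).

Lemma generates_mem M S i : generates M S -> (i < size S)%N -> M S`_i.
Proof.
move=> gS hi; apply/gS; exists (fun j => (j == Ordinal hi)%:R); split.
  by move=> j; case: (j == _); rewrite ?rpred0 ?rpred1.
rewrite /sym_comb (bigD1 (Ordinal hi)) //= eqxx mul1r big1 ?addr0 //.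
by move=> j /negPf ->; rewrite mul0r.
Qed.

(** Rank is well defined over a commutative ring: a free generating set is a smallest one. *)
Lemma free_size_min M S T :
  freely_generates M S -> generates M T -> (size S <= size T)%N.
Proof.
case=> gS fS gT.
have /fin_all_exists [A hA] : forall i : 'I_(size S), exists r : 'I_(size T) -> {mpoly k[3]},
    (forall j, r j \is symmetric) /\ S`_i = sym_comb r.
  by move=> i; apply/gT; exact: generates_mem gS (ltn_ord i).
have /fin_all_exists [B hB] : forall i : 'I_(size T), exists r : 'I_(size S) -> {mpoly k[3]},
    (forall j, r j \is symmetric) /\ T`_i = sym_comb r.
  by move=> i; apply/gS; exact: generates_mem gT (ltn_ord i).
pose MA := \matrix_(i, j) A i j; pose MB := \matrix_(i, j) B i j.
(* Each set expresses the other; freeness of $S$ makes the product of the two coefficient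
   matrices the identity, and that is impossible when it factors through a smaller size. *)
suff: MA *m MB = 1%:M by apply: mulmx1_min.
apply/matrixP => i l; apply/eqP; rewrite -subr_eq0; apply/eqP.
apply: (fS (fun l => (MA *m MB) i l - 1%:M i l)) => [j|].
  rewrite rpredB //; last by rewrite mxE; case: eqP => _; rewrite ?rpred0 ?rpred1.
  rewrite mxE rpred_sum // => t _; rewrite !mxE rpredM //; first by case: (hA i).
  by case: (hB t).
rewrite /sym_comb; under eq_bigr do rewrite mulrBl.
rewrite sumrB; apply/eqP; rewrite subr_eq0; apply/eqP.
rewrite [RHS](bigD1 i) //= mxE eqxx mul1r [X in _ = _ + X]big1 ?addr0; last first.
  by move=> j ji; rewrite mxE eq_sym (negPf ji) mul0r.
have [_ ->] := hA i; rewrite /sym_comb.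
have hB2 (t : 'I_(size T)) : T`_t = \sum_(l < size S) B t l * S`_l by case: (hB t).
under [RHS]eq_bigr => t _ do rewrite hB2 mulr_sumr.
rewrite exchange_big /=; apply: eq_bigr => j _; rewrite mxE mulr_suml.
by apply: eq_bigr => t _; rewrite !mxE mulrA.
Qed.

Lemma free_minimal_generator M S g :
  freely_generates M S -> (forall h, h \in S -> is_homogeneous h) -> g \in S ->
  minimal_generator M g.
Proof.
move=> fS hS gS; exists S; split => //; first by split => //; case: fS.
by move=> T [gT _]; apply: free_size_min fS gT.
Qed.
End Generators.

Section Quasi.
Variable k : fieldType.
Implicit Types f g h p K : {mpoly k[3]}.

Lemma diff_prodE e : diff_prod k e = vdm k ^+ e.
Proof.
rewrite /diff_prod -(pair_big_dep xpredT (fun i j : 'I_3 => (i < j)%N)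
  (fun i j => ('X_i - 'X_j : {mpoly k[3]}) ^+ e)) /=.
rewrite !big_ord_recl big_ord0 /=.
do 3! rewrite big_mkcond !big_ord_recl big_ord0 /=.
rewrite !mul1r !mulr1 vdmE !exprMn.
congr (_ ^+ _ * _ ^+ _ * _ ^+ _); congr ('X_ _ - 'X_ _); exact/val_inj.
Qed.

(** Conjugation permutes the three divisibility conditions. *)
Lemma quasi_msym m K s : quasi_invariant m K -> quasi_invariant m (msym s K).
Proof.
move=> qK i j ij.
have on : odd (2 * m + 1) by rewrite oddD oddM.
have {}qK (a b : 'I_3) : a != b ->
    exists q, K - msym (tperm a b) K = q * ('X_a - 'X_b) ^+ (2 * m + 1).
  move=> nab; case: (ltngtP a b) => [/qK //|/qK [q hq]|/val_inj /eqP]; last by rewrite (negPf nab).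
  exists (- q); rewrite tpermC hq -opprB exprNn -signr_odd on expr1; ring.
have nij : i != j by apply: contraL ij => /eqP ->; rewrite ltnn.
have [|q hq] := qK (s^-1 i)%g (s^-1 j)%g; first by rewrite (inj_eq perm_inj).
exists (msym s q); rewrite -{2}(permKV s i) -{2}(permKV s j).
rewrite -[in RHS](msymXU _ s) -[in RHS](msymXU _ s) -msymB -rmorphXn -msymM -hq msymB.
congr (_ - _); rewrite -!msymMm; congr (msym _ K).
have -> : tperm i j = (tperm ((s^-1)%g i) ((s^-1)%g j) ^ s)%g by rewrite tpermJ !permKV.
by rewrite conjgE mulKVg.
Qed.

Lemma quasi0 m : quasi_invariant m (0 : {mpoly k[3]}).
Proof. by move=> i j _; exists 0; rewrite msym0 subrr mul0r. Qed.

Lemma quasiD m f g : quasi_invariant m f -> quasi_invariant m g -> quasi_invariant m (f + g).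
Proof.
move=> hf hg i j ij; have [q hq] := hf i j ij; have [q' hq'] := hg i j ij.
by exists (q + q'); rewrite msymD mulrDl -hq -hq'; ring.
Qed.

Lemma quasi_symM m r f : r \is symmetric -> quasi_invariant m f -> quasi_invariant m (r * f).
Proof.
move=> /issymP hr hf i j ij; have [q hq] := hf i j ij.
by exists (r * q); rewrite msymM hr -mulrA -hq; ring.
Qed.

Lemma quasi_sym m r : r \is symmetric -> quasi_invariant m (r : {mpoly k[3]}).
Proof. by move=> /issymP hr i j ij; exists 0; rewrite hr subrr mul0r. Qed.

Lemma quasiN m f : quasi_invariant m f -> quasi_invariant m (- f).
Proof. by move=> h; rewrite -mulN1r; apply: quasi_symM; rewrite // rpredN1. Qed.

Lemma quasiZ m c f : quasi_invariant m f -> quasi_invariant m (c *: f).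
Proof.
move=> h; rewrite -mul_mpolyC; apply: quasi_symM => //.
by apply/issymP => s; rewrite -[c%:MP]mulr1 mul_mpolyC msymZ msym1.
Qed.

Lemma quasi_y12_dvd m f : quasi_invariant m f ->
  exists q, f - msym s12 f = q * y12 k ^+ (2 * m + 1).
Proof. by move=> /(_ i0 i1 isT). Qed.

Hypothesis k2 : 2%:R != 0 :> k.

Lemma scale2_inv f g : 2%:R *: f = g -> f = 2%:R^-1 *: g.
Proof. by move=> <-; rewrite scalerA mulVf // scale1r. Qed.

Lemma anti_quasi_dvd m f : quasi_invariant m f -> msym s12 f = - f ->
  exists q, f = q * y12 k ^+ (2 * m + 1).
Proof.
move=> /quasi_y12_dvd [q hq] hf; exists (2%:R^-1 *: q); rewrite -scalerAl -hq hf opprK.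
by apply: scale2_inv; rewrite scaler_nat mulr2n.
Qed.

(** The condition for $s_{12}$ is built into the definition, as $f - s_{12}f = 2f$. For the two
    other transpositions, trace zero gives $f - sf = -c^{\pm1}f$, which is divisible by the
    conjugate mirror equation. *)
Lemma twisted_quasi m f : twisted (2 * m + 1) f -> quasi_invariant m f.
Proof.
move=> tf; have [sf tr [q hq]] := tf; set n := (2 * m + 1)%N in hq *.
have on : odd n by rewrite /n oddD oddM.
have [t02 t12] := tperm3E.
have key (i j : 'I_3) : [\/ i = i0 /\ j = i1, i = i0 /\ j = i2 | i = i1 /\ j = i2] ->
    exists q, f - msym (tperm i j) f = q * ('X_i - 'X_j) ^+ n.
  case=> [[-> ->]|[-> ->]|[-> ->]].
  - exists (2%:R * q); rewrite -/s12 sf -mulrA -/(y12 k) -hq; ring.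
  - exists (cyc (cyc q)).
    rewrite t02 msymMm sf -cycE cycN opprK.
    have -> : f + cyc f = - cyc (cyc f) by rewrite (twisted_cyc2 tf); ring.
    rewrite hq !cycM !cycXn cyc_y12 cycB !cyc_X -[in LHS]opprB exprNn -signr_odd on; ring.
  - exists (- cyc q); rewrite t12 !msymMm sf -!cycE !cycN opprK (twisted_cyc2 tf).
    have -> : f + (- f - cyc f) = - cyc f by ring.
    by rewrite hq cycM cycXn cyc_y12; ring.
move=> i j ij; apply: key; move: ij.
by case: (I3P i) => ->; case: (I3P j) => -> // _; [constructor 1|constructor 2|constructor 3].
Qed.

(** The trace under the 3-cycle is antisymmetric, and $(x_1-x_2)^{2m+1}$ divides it term by term: it
    divides $f$, and $cf + c^2f = cf - s_{12}(cf)$. *)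
Lemma quasi_trace_dvd m f : quasi_invariant m f -> msym s12 f = - f ->
  exists2 r, r \is symmetric & f + cyc f + cyc (cyc f) = r * vdm k ^+ (2 * m + 1).
Proof.
move=> qf hf; have [q hq] := anti_quasi_dvd qf hf.
have on : odd (2 * m + 1) by rewrite oddD oddM.
have [q' hq'] := quasi_y12_dvd (quasi_msym c3 qf); rewrite -cycE in hq'.
have e : msym s12 (cyc f) = - cyc (cyc f) by rewrite s12_cyc hf !cycN.
apply: (@antisym_dvd k _ _ (q + q')) => //.
- rewrite !msymD !s12_cyc hf !cycN cyc3; ring.
- rewrite !cycD cyc3; ring.
- by rewrite mulrDl -hq' -hq e opprK addrA.
Qed.

(** Below the degree of the antisymmetric generator, the trace has no room to be nonzero. *)
Lemma quasi_twisted m d f : quasi_invariant m f -> msym s12 f = - f ->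
  f \is d.-homog -> (d < 6 * m + 3)%N -> twisted (2 * m + 1) f.
Proof.
move=> qf hf df ld; split => //; last exact: anti_quasi_dvd.
have [r _ hr] := quasi_trace_dvd qf hf.
apply/eqP; apply: contraT => t0; move: t0 (hr) => /[dup] t0'; rewrite hr => t0 _.
have r0 : r != 0 by apply: contra_neq t0 => ->; rewrite mul0r.
have v0 : vdm k ^+ (2 * m + 1) != 0 by rewrite expf_neq0 // vdm_neq0.
have sv := dhomog_msizeE v0 (dhomogMn (2 * m + 1) (vdm_dhomog k)).
have dT : f + cyc f + cyc (cyc f) \is d.-homog by rewrite !rpredD ?cyc_dhomog.
have := dhomog_msizeE t0' dT; rewrite hr msizeM // sv.
by move: r0; rewrite -msize_poly_eq0; lia.
Qed.
End Quasi.

(** * Free generators of the quasi-invariants when 2 and 3 are invertible *)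

(** On the two-dimensional representation this exchanges the two eigenspaces of $s_{12}$; up to the
    factor $\sqrt{-3}$ it is an involution. *)
HB.lock Definition mirror (k : fieldType) (f : {mpoly k[3]}) := cyc f - cyc (cyc f).

Section GoodChar.
Variable k : fieldType.
Hypotheses (k2 : 2%:R != 0 :> k) (k3 : 3%:R != 0 :> k).
Implicit Types f g h p K : {mpoly k[3]}.

Local Notation mirror := (@mirror k).
Lemma mirrorE f : mirror f = cyc f - cyc (cyc f). Proof. by rewrite mirror.unlock. Qed.

Ltac mring' := repeat match goal with
  | |- context [@mirror ?k ?f] => generalize (@mirror k f); intro end; mring.

Lemma mirrorD f g : mirror (f + g) = mirror f + mirror g.
Proof. by rewrite !mirrorE !cycD; mring. Qed.

Lemma mirror_symM r f : cyc r = r -> mirror (r * f) = r * mirror f.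
Proof. by move=> hr; rewrite !mirrorE !cycM !hr; mring. Qed.

Lemma mirrorK f : f + cyc f + cyc (cyc f) = 0 -> mirror (mirror f) = - (3%:R * f).
Proof.
move=> tr; rewrite !mirrorE !cycB !cyc3.
have -> : cyc (cyc f) = - f - cyc f by apply/eqP; rewrite -subr_eq0 -tr; apply/eqP; mring.
mring.
Qed.

Lemma trace_mirror f : mirror f + cyc (mirror f) + cyc (cyc (mirror f)) = 0.
Proof. by rewrite !mirrorE !cycB !cyc3; mring. Qed.

Lemma s12_mirror_anti f : msym s12 f = - f -> msym s12 (mirror f) = mirror f.
Proof. by move=> h; rewrite !mirrorE msymB !s12_cyc h !cycN cyc3; mring. Qed.

Lemma s12_mirror_inv f : msym s12 f = f -> msym s12 (mirror f) = - mirror f.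
Proof. by move=> h; rewrite !mirrorE msymB !s12_cyc h cyc3; mring. Qed.

Lemma cycZ c f : cyc (c *: f) = c *: cyc f. Proof. by rewrite !cycE msymZ. Qed.

Lemma scale_natK n f g : n%:R != 0 :> k -> n%:R * f = g -> f = n%:R^-1 *: g.
Proof. by move=> n0 <-; rewrite mulr_natl -scaler_nat scalerA mulVf // scale1r. Qed.

Lemma trace_sub_mean f S : cyc S = S -> 3%:R * S = f + cyc f + cyc (cyc f) ->
  (f - S) + cyc (f - S) + cyc (cyc (f - S)) = 0.
Proof.
move=> cS hS; rewrite !cycB !cS.
transitivity (f + cyc f + cyc (cyc f) - 3%:R * S); first by mring.
by rewrite hS subrr.
Qed.

Lemma six_terms_rearrange (a b c s d e : {mpoly k[3]}) :
  a + b + c + (s + (- d - e)) = s + a + b - d + c - e.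
Proof. by ring. Qed.

Variables (m : nat) (d1 d2 : nat) (P P' : {mpoly k[3]}).
Let n := (2 * m + 1)%N.
Hypotheses (tP : twisted n P) (tP' : twisted n P').
Hypotheses (hP : P \is d1.-homog) (hP' : P' \is d2.-homog).
Hypotheses (ed : (d1 + d2 = 3 * n)%N) (w0 : wronsk P P' != 0).

(** A twisted $P$ and its mirror image span a two-dimensional representation, with one vector in
    each eigenspace of $s_{12}$. *)
Definition six_generators := [:: 1; vdm k ^+ n; P; mirror P; P'; mirror P'].

Lemma six_combE (F : 'I_(size six_generators) -> {mpoly k[3]}) (r : nat -> {mpoly k[3]}) :
  (forall i, F i = r i) ->
  sym_comb F = r 0 + r 1 * vdm k ^+ n + r 2 * P + r 3 * mirror P + r 4 * P' + r 5 * mirror P'.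
Proof.
move=> h; rewrite /sym_comb !big_ord_recl big_ord0 /= !h /= /bump /= mulr1.
move: (r 0) (r 1) (r 2) (r 3) (r 4) (r 5) => a b c d e f; mring'.
Qed.

Lemma odd_n : odd n. Proof. by rewrite /n oddD oddM. Qed.

(** The $(-1)$-eigenspace of $s_{12}$ is the sum of its antisymmetric part and its twisted part. *)
Lemma anti_decomp K : quasi_invariant m K -> msym s12 K = - K ->
  exists r0 r1 r2, [/\ r0 \is symmetric, r1 \is symmetric, r2 \is symmetric
   & K = r0 * vdm k ^+ n + r1 * P + r2 * P'].
Proof.
move=> qK sK; have [r sr hr] := quasi_trace_dvd k2 qK sK.
(* The trace of $K$ is $r$ times an odd power of the Vandermonde polynomial, which is itself
   $c$-invariant, so subtracting a third of it leaves trace zero. *)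
pose f := K - 3%:R^-1 *: (r * vdm k ^+ n).
have sv : msym s12 (r * vdm k ^+ n) = - (r * vdm k ^+ n).
  have [h1 h2] := (symmetricP r).1 sr.
  by rewrite msymM h1 rmorphXn /= s12_vdm exprNn -signr_odd odd_n expr1; mring.
have cv : cyc (r * vdm k ^+ n) = r * vdm k ^+ n.
  have [h1 h2] := (symmetricP r).1 sr.
  by rewrite cycM cycXn h2 cyc_vdm.
have tf : twisted n f.
  split.
  - by rewrite /f msymB msymZ sK sv; rewrite scalerN opprD.
  - rewrite /f !cycB !cycZ !cv.
    have e : r * vdm k ^+ n = 3%:R * (3%:R^-1 *: (r * vdm k ^+ n)).
      by rewrite mulr_natl -scaler_nat scalerA mulfV // scale1r.
    move: hr; rewrite {1}e; move: (_ *: _) => V hr.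
    transitivity (K + cyc K + cyc (cyc K) - 3%:R * V); first by mring.
    by rewrite hr subrr.
  - have [q hq] := anti_quasi_dvd k2 qK sK.
    exists (q - 3%:R^-1 *: (r * (('X_0 - 'X_i2) * ('X_1 - 'X_i2)) ^+ n)).
    rewrite /f hq mulrBl; congr (_ - _); rewrite -scalerAl; congr (_ *: _).
    by rewrite -mulrA -exprMn; congr (_ * _ ^+ _); rewrite vdmE /y12; mring.
have [r1 [r2 [s1 s2 h]]] := saito odd_n tP tP' hP hP' ed w0 tf.
exists (3%:R^-1 *: r), r1, r2; split => //; first exact: rpredZ.
by rewrite -scalerAl -addrA -h addrC subrK.
Qed.

Lemma six_generators_quasi i : quasi_invariant m six_generators`_i.
Proof.
have qv : quasi_invariant m (vdm k ^+ n).
  have [t02 t12] := tperm3E; have on := odd_n.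
  have sv t : msym t (vdm k) = - vdm k -> msym t (vdm k ^+ n) = - vdm k ^+ n.
    by move=> h; rewrite rmorphXn /= h exprNn -signr_odd on expr1 mulN1r.
  have v12 := s12_vdm k.
  have v02 : msym (tperm i0 i2) (vdm k) = - vdm k.
    by rewrite t02 msymMm v12 -cycE cycN cyc_vdm.
  have v23 : msym (tperm i1 i2) (vdm k) = - vdm k.
    by rewrite t12 !msymMm v12 -!cycE !cycN !cyc_vdm.
  have e u (a b : {mpoly k[3]}) : u = - vdm k ^+ n -> vdm k = a * b ->
      exists q, vdm k ^+ n - u = q * b ^+ n.
    by move=> -> ->; exists (2%:R * a ^+ n); rewrite exprMn; mring.
  move=> a b; case: (I3P a) => ->; case: (I3P b) => -> // _.
  - by apply: (e _ (('X_0 - 'X_i2) * ('X_1 - 'X_i2))); [apply: sv|rewrite vdmE; ring].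
  - by apply: (e _ (('X_0 - 'X_1) * ('X_1 - 'X_i2))); [apply: sv|rewrite vdmE; ring].
  - by apply: (e _ (('X_0 - 'X_1) * ('X_0 - 'X_i2))); [apply: sv|rewrite vdmE; ring].
have q1 := twisted_quasi tP; have q2 := twisted_quasi tP'.
have qm f : quasi_invariant m f -> quasi_invariant m (mirror f).
  by move=> q; rewrite !mirrorE !cycE; apply: quasiD; [|apply: quasiN]; do ?apply: quasi_msym.
case: i => [|[|[|[|[|[|i]]]]]]; last by rewrite nth_default //; exact: quasi0.
- by apply: quasi_sym; apply: rpred1.
- exact: qv.
- exact: q1.
- exact: (qm _ q1).
- exact: q2.
- exact: (qm _ q2).
Qed.

(** Spanning reduces to the $(-1)$-eigenspace by means of the mirror map, and so does freeness,
    where the wronskian takes over. *)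
Lemma six_generators_free : freely_generates (@quasi_invariant k m) six_generators.
Proof.
split=> [K|F sF]; first split.
- move=> qK.
  have qA : quasi_invariant m (2%:R^-1 *: (K - msym s12 K)).
    by apply: quasiZ; apply: quasiD => //; apply: quasiN; apply: quasi_msym.
  have sA : msym s12 (2%:R^-1 *: (K - msym s12 K)) = - (2%:R^-1 *: (K - msym s12 K)).
    by rewrite msymZ msymB s12K -scalerN opprB.
  have [r0 [r1 [r2 [s0 s1 s2 hA]]]] := anti_decomp qA sA.
  set A := _ *: _ in qA sA hA.
  pose B := 2%:R^-1 *: (K + msym s12 K).
  have KAB : K = A + B.
    rewrite /A /B -scalerDr addrACA addNr addr0 -mulr2n -scaler_nat scalerA mulVf //.
    by rewrite scale1r.
  have qB : quasi_invariant m B.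
    by apply: quasiZ; apply: quasiD => //; apply: quasi_msym.
  have sB : msym s12 B = B by rewrite msymZ msymD s12K addrC.
  (* The $s_{12}$-invariant part $B$ is its symmetrization $S$ plus an invariant $u$ of trace
     zero; mirror carries $u$ to the $(-1)$-eigenspace, and mirroring twice multiplies it by $-3$. *)
  pose S := 3%:R^-1 *: (B + cyc B + cyc (cyc B)).
  have hS : 3%:R * S = B + cyc B + cyc (cyc B).
    by rewrite mulr_natl -scaler_nat scalerA mulfV // scale1r.
  have sS : S \is symmetric.
    apply: rpredZ; apply/symmetricP; split; last by rewrite !cycD cyc3; mring.
    rewrite !msymD !s12_cyc sB cyc3; mring.
  have [sS1 sS2] := (symmetricP S).1 sS.
  pose u := B - S.
  have tu : u + cyc u + cyc (cyc u) = 0 by exact: trace_sub_mean.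
  have su : msym s12 u = u by rewrite msymB sB sS1.
  have qu : quasi_invariant m u by apply: quasiD => //; apply: quasiN; apply: quasi_sym.
  have qv : quasi_invariant m (mirror u).
    by rewrite !mirrorE !cycE; apply: quasiD; [|apply: quasiN]; do ?apply: quasi_msym.
  have [t0 [t1 [t2 [st0 st1 st2 hv]]]] := anti_decomp qv (s12_mirror_inv su).
  have [_ ct0] := (symmetricP t0).1 st0.
  have [_ ct1] := (symmetricP t1).1 st1.
  have [_ ct2] := (symmetricP t2).1 st2.
  have mV : mirror (t0 * vdm k ^+ n) = 0.
    by rewrite mirror_symM // mirrorE !cycXn !cyc_vdm subrr mulr0.
  have := mirrorK tu; rewrite {1}hv !mirrorD mV add0r !mirror_symM // => /eqP.
  rewrite -eqr_oppLR opprD => /eqP /esym /(scale_natK k3) hu.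
  pose r := nth 0 [:: S; r0; r1; - (3%:R^-1 *: t1); r2; - (3%:R^-1 *: t2)].
  exists (fun i => r i); split.
    by case=> [[|[|[|[|[|[|i]]]]]] hi] //=; rewrite ?rpredN ?rpredZ.
  rewrite (@six_combE _ r) // /r /= {1}KAB hA.
  have -> : B = S + u by rewrite /u addrC subrK.
  rewrite hu scalerDr !scalerN !scalerAl !mulNr; exact: six_terms_rearrange.
- case=> F [sF ->]; rewrite /sym_comb.
  elim/big_rec: _ => [|i f _ qf]; first exact: quasi0.
  by apply: quasiD => //; apply: quasi_symM => //; apply: six_generators_quasi.
pose r j := if insub j is Some i then F i else 0.
have rF i : F i = r i by rewrite /r valK.
have sr j : r j \is symmetric by rewrite /r; case: insubP => *; rewrite ?rpred0.
have s12r j : msym s12 (r j) = r j by case: (symmetricP (r j)).1.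
have cr j : cyc (r j) = r j by case: (symmetricP (r j)).1.
rewrite (six_combE rF) => e0.
have [sP trP _] := tP; have [sP' trP' _] := tP'.
(* In a relation, $s_{12}$ separates the invariant generators from the anti-invariant ones. *)
have e1 : r 0 + r 3 * mirror P + r 5 * mirror P' = r 1 * vdm k ^+ n + r 2 * P + r 4 * P'.
  have := congr1 (msym s12) e0.
  rewrite !(msymD, msymM) !s12r (s12_mirror_anti sP) (s12_mirror_anti sP') sP sP' msym0.
  rewrite rmorphXn /= s12_vdm exprNn -signr_odd odd_n expr1 mulN1r => e1.
  apply/eqP; rewrite -subr_eq0 -e1; apply/eqP; mring.
have e2 : r 0 + r 3 * mirror P + r 5 * mirror P' = 0.
  apply: (mulfI (x := 2%:R)); first by rewrite -mpolyC_nat mpolyC_eq0.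
  by rewrite mulr0 -e0 mulr2n mulrDl !mul1r {2}e1; mring.
have e3 : r 1 * vdm k ^+ n + r 2 * P + r 4 * P' = 0 by rewrite -e1.
have tr0 g h : g = 0 -> h = g + cyc g + cyc (cyc g) -> h = 0 :> {mpoly k[3]}.
  by move=> -> ->; rewrite !cyc0 !addr0.
have n3 : 3%:R != 0 :> {mpoly k[3]} by rewrite -mpolyC_nat mpolyC_eq0.
have r00 : r 0 = 0.
  apply: (mulfI n3); rewrite mulr0; apply: (tr0 _ _ e2).
  rewrite !(cycD, cycM) !cr.
  have := trace_mirror P; have := trace_mirror P'.
  move: (mirror P) (mirror P') => a b tb ta.
  transitivity (3%:R * r 0 + r 3 * (a + cyc a + cyc (cyc a)) + r 5 * (b + cyc b + cyc (cyc b))).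
    by rewrite ta tb; mring.
  mring.
have r10 : r 1 = 0.
  apply: (mulfI n3); rewrite mulr0; apply: (mulIf (x := vdm k ^+ n)).
    by rewrite expf_neq0 // vdm_neq0.
  rewrite mul0r; apply: (tr0 _ _ e3).
  rewrite !(cycD, cycM, cycXn) !cr !cyc_vdm.
  transitivity (3%:R * r 1 * vdm k ^+ n + r 2 * (P + cyc P + cyc (cyc P)) + r 4 * (P' + cyc P' + cyc (cyc P'))).
    by rewrite trP trP'; mring.
  mring.
have [r20 r40] : r 2 = 0 /\ r 4 = 0.
  by apply: (wronsk_free w0) => //; rewrite -e3 r10; mring.
have [r30 r50] : r 3 = 0 /\ r 5 = 0.
  apply: (wronsk_free w0) => //; apply: (mulfI n3); rewrite mulr0.
  have : mirror (r 3 * mirror P + r 5 * mirror P') = 0.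
    by move: e2; rewrite r00 add0r => ->; rewrite !mirrorE !cyc0 subrr.
  rewrite mirrorD !mirror_symM // (mirrorK trP) (mirrorK trP') => h.
  by rewrite -[RHS]oppr0 -h; mring.
move=> i; rewrite rF; case: i => [[|[|[|[|[|[|i]]]]]] hi] //=.
Qed.
End GoodChar.

(** * Formal integration *)

(** Rings in which formal primitives of polynomials exist. *)
Definition rational_ring (A : comUnitRingType) := forall n, n.+1%:R \is a @GRing.unit A.

Section Integral.
Variable A : comUnitRingType.
Hypothesis A0 : rational_ring A.
Implicit Types p q : {poly A}.

(** The summand of index $0$ vanishes because $0^{-1} = 0$ in a unit ring. *)
Definition primitive p : {poly A} := \poly_(i < (size p).+1) (i%:R^-1 * p`_i.-1).

Lemma deriv_primitive p : (primitive p)^`() = p.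
Proof.
apply/polyP => i; rewrite coef_deriv coef_poly ltnS /=.
case: ltnP => hi; last by rewrite mul0rn nth_default.
by rewrite -mulrnAl -[_^-1 *+ _]mulr_natr mulVr // mul1r.
Qed.

Lemma deriv_eq0 p : p^`() = 0 -> p = (p`_0)%:P.
Proof.
move=> h; apply/polyP => -[|i]; rewrite coefC //=.
have := congr1 (fun q : {poly A} => q`_i) h.
rewrite coef_deriv coef0 -mulr_natl => /(congr1 (fun x => i.+1%:R^-1 * x)).
by rewrite mulr0 mulrA mulVr // mul1r.
Qed.

Definition integral p a b := (primitive p).[b] - (primitive p).[a].

Lemma integral_deriv q a b : integral q^`() a b = q.[b] - q.[a].
Proof.
have /deriv_eq0 : (primitive q^`() - q)^`() = 0 by rewrite derivB deriv_primitive subrr.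
move/eqP; rewrite subr_eq => /eqP h.
by rewrite /integral h !hornerD !hornerC; ring.
Qed.

Lemma integralE p q a b : q^`() = p -> integral p a b = q.[b] - q.[a].
Proof. by move=> <-; exact: integral_deriv. Qed.

Lemma integralD p q a b : integral (p + q) a b = integral p a b + integral q a b.
Proof.
rewrite (@integralE (p + q) (primitive p + primitive q)) ?derivD ?deriv_primitive //.
by rewrite /integral !hornerD; ring.
Qed.

Lemma integralZ c p a b : integral (c *: p) a b = c * integral p a b.
Proof.
rewrite (@integralE (c *: p) (c *: primitive p)) ?derivZ ?deriv_primitive //.
by rewrite /integral !hornerZ; ring.
Qed.

(** The substitution $t = a + ws$. *)
Lemma integral_comp p a w :
  integral p a (a + w) = w * integral (p \Po (a%:P + w *: 'X)) 0 1.
Proof.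
rewrite -integralZ.
rewrite [RHS](@integralE _ (primitive p \Po (a%:P + w *: 'X))); last first.
  rewrite deriv_comp deriv_primitive derivD derivC derivZ derivX add0r.
  by rewrite -scalerAr mulr1.
by rewrite !horner_comp !(hornerD, hornerC, hornerZ, hornerX) mulr0 mulr1 addr0.
Qed.
End Integral.

Lemma rmorph_integral (A B : comUnitRingType) (phi : {rmorphism A -> B}) p a b :
  rational_ring A -> rational_ring B ->
  phi (integral p a b) = integral (map_poly phi p) (phi a) (phi b).
Proof.
move=> hA hB; rewrite (@integralE B hB _ (map_poly phi (primitive p))).
  by rewrite /integral rmorphB !horner_map.
by rewrite deriv_map deriv_primitive.
Qed.

Lemma rational_ring_rat : rational_ring rat.
Proof. by move=> n; rewrite unitfE Num.Theory.pnatr_eq0. Qed.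

Lemma rational_ring_mpoly n : rational_ring {mpoly rat[n]}.
Proof.
move=> i; rewrite -mpolyC_nat.
apply/unitrPr; exists (i.+1%:R^-1)%:MP.
by rewrite -mpolyCM mulfV // Num.Theory.pnatr_eq0.
Qed.

(** Up to sign these are the beta integrals $a!\,b!/(a+b+1)!$; integration by parts lowers $b$. *)
Lemma beta_neq0 a b : integral ('X^a * ('X - 1%:P) ^+ b : {poly rat}) 0 1 != 0.
Proof.
elim: b a => [|b IH] a.
  rewrite (@integralE _ rational_ring_rat _ (a.+1%:R^-1 *: 'X^(a.+1))); last first.
    by rewrite derivZ derivXn mulr1 -scaler_nat scalerA mulVf ?scale1r // Num.Theory.pnatr_eq0.
  rewrite !hornerZ !hornerXn expr1n expr0n /= mulr0 subr0 mulr1.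
  by rewrite invr_eq0 Num.Theory.pnatr_eq0.
(* Integration by parts; the boundary terms vanish because both exponents are positive. *)
have := @integral_deriv _ rational_ring_rat ('X^(a.+1) * ('X - 1%:P) ^+ b.+1) 0 1.
rewrite !hornerM !hornerXn !horner_exp !hornerXsubC subrr !expr0n /= mulr0 mul0r subrr.
have -> : ('X^(a.+1) * ('X - 1%:P) ^+ b.+1)^`() =
   a.+1%:R *: ('X^a * ('X - 1%:P) ^+ b.+1) + b.+1%:R *: ('X^(a.+1) * ('X - 1%:P) ^+ b) :> {poly rat}.
  rewrite derivM derivXn deriv_exp derivXsubC mul1r /=.
  by rewrite !scaler_nat mulrnAl mulrnAr.
rewrite integralD ?integralZ; try exact: rational_ring_rat.
move=> e; apply/eqP => h; move: e; rewrite h mulr0 add0r => /eqP.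
by rewrite mulf_eq0 Num.Theory.pnatr_eq0 /= (negPf (IH _)).
Qed.

(** * Felder--Veselov integrals *)

Section Cubic.
Variable R : comUnitRingType.
Implicit Types a b c : R.

Definition cubic j m a b c : {poly R} :=
  'X^j * (('X - a%:P) * ('X - b%:P) * ('X - c%:P)) ^+ m.

Lemma cubicCA j m a b c : cubic j m b a c = cubic j m a b c.
Proof. by rewrite /cubic; congr (_ * (_ * _) ^+ _); rewrite mulrC. Qed.

Lemma cubic_rot j m a b c : cubic j m b c a = cubic j m a b c.
Proof. by rewrite /cubic; congr (_ * _ ^+ _); rewrite mulrC mulrA. Qed.

Definition line a w : {poly R} := a%:P + w *: 'X.

(** What remains of the cubic on the segment from $a$ to $a+w$, parametrized by $[0,1]$, after the
    factors $w$ are taken out. *)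
Definition cubic_line j m a w c : {poly R} :=
  line a w ^+ j * ('X * ('X - 1%:P) * (line a w - c%:P)) ^+ m.

Lemma cubic_comp j m a w c :
  cubic j m a (a + w) c \Po line a w = w ^+ (2 * m) *: cubic_line j m a w c.
Proof.
rewrite /cubic rmorphM !rmorphXn /= comp_polyX !rmorphM !rmorphB /= comp_polyX !comp_polyC.
have -> : line a w - a%:P = w *: 'X by rewrite /line addrC addKr.
have -> : line a w - (a + w)%:P = w *: ('X - 1%:P).
  by rewrite /line scalerBr -!mul_polyC mulr1 polyCD; ring.
have -> : w *: 'X * (w *: ('X - 1%:P)) * (line a w - c%:P)
    = w ^+ 2 *: ('X * ('X - 1%:P) * (line a w - c%:P)).
  by rewrite -!mul_polyC rmorphXn /=; ring.
by rewrite exprZn -exprM -scalerAr.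
Qed.

(** The integrand vanishes to order $m$ at both end points, so rescaling the segment to $[0,1]$
    extracts $(b-a)^m$ twice, and once more $b-a$ from the differential. *)
Lemma integral_cubic j m a b c : rational_ring R ->
  integral (cubic j m a b c) a b =
    (b - a) ^+ (2 * m + 1) * integral (cubic_line j m a (b - a) c) 0 1.
Proof.
move=> R0; have {1 2}-> : b = a + (b - a) by rewrite addrC subrK.
rewrite integral_comp // -/(line _ _) cubic_comp integralZ // mulrA -exprS.
by rewrite addn1.
Qed.
End Cubic.

Lemma map_cubic (R S : comUnitRingType) (phi : {rmorphism R -> S}) j m a b c :
  map_poly phi (cubic j m a b c) = cubic j m (phi a) (phi b) (phi c).
Proof.
by rewrite /cubic rmorphM !rmorphXn /= map_polyX !rmorphM !rmorphB /= map_polyX !map_polyC.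
Qed.

Lemma map_cubic_line (R S : comUnitRingType) (phi : {rmorphism R -> S}) j m a w c :
  map_poly phi (cubic_line j m a w c) = cubic_line j m (phi a) (phi w) (phi c).
Proof.
have pl : map_poly phi (line a w) = line (phi a) (phi w).
  by rewrite /line rmorphD /= map_polyC map_polyZ /= map_polyX.
rewrite /cubic_line rmorphM !rmorphXn /= pl !rmorphM !rmorphB /= pl map_polyX !map_polyC.
by rewrite /= rmorph1.
Qed.

Local Notation MQ := {mpoly rat[3]}.
Local Notation u0 := ('X_i0 : MQ).
Local Notation u1 := ('X_i1 : MQ).
Local Notation u2 := ('X_i2 : MQ).

(** The Felder--Veselov integrals: the integrand is symmetric in the $x_i$, so permuting variables
    only moves the end points. *)
HB.lock Definition fv (m j : nat) (a b : MQ) : MQ := integral (cubic j m u0 u1 u2) a b.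

Section FelderVeselov.
Variable m : nat.
Let n := (2 * m + 1)%N.
Local Notation fv := (fv m).

Lemma fvE j a b : fv j a b = integral (cubic j m u0 u1 u2) a b.
Proof. by rewrite fv.unlock. Qed.

Lemma s12_fv j a b : msym s12 (fv j a b) = fv j (msym s12 a) (msym s12 b).
Proof.
rewrite !fvE (rmorph_integral (msym s12) _ _ _ (@rational_ring_mpoly 3) (@rational_ring_mpoly 3)).
by rewrite map_cubic /= !s12_X cubicCA.
Qed.

Lemma cyc_fv j a b : cyc (fv j a b) = fv j (cyc a) (cyc b).
Proof.
rewrite !cycE !fvE (rmorph_integral (msym c3) _ _ _ (@rational_ring_mpoly 3) (@rational_ring_mpoly 3)).
by rewrite map_cubic /= -!cycE !cyc_X cubic_rot.
Qed.

Lemma fv_factor j : fv j u0 u1 = (u1 - u0) ^+ n * integral (cubic_line j m u0 (u1 - u0) u2) 0 1.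
Proof. by rewrite fvE; exact: integral_cubic (@rational_ring_mpoly 3). Qed.

(** Exchanging the end points changes the sign, and the integrals along the three sides of a
    triangle add up to zero. *)
Lemma fv_twisted j : twisted n (fv j u0 u1).
Proof.
split.
- by rewrite s12_fv !s12_X !fvE /integral opprB.
- rewrite !cyc_fv !cyc_X !fvE /integral; move: (horner _ _) (horner _ _) (horner _ _) => a b c; ring.
- exists ((-1) ^+ n * integral (cubic_line j m u0 (u1 - u0) u2) 0 1).
  rewrite fv_factor; move: (integral _ _ _) => I0.
  have -> : u1 - u0 = - y12 _ by rewrite /y12 opprB.
  by rewrite [(- y12 _) ^+ n]exprNn mulrAC.
Qed.

(** Joint homogeneity of degree $d$ in the integration variable and the $x_i$. *)
Definition graded d (p : {poly MQ}) :=
  forall i, if (i <= d)%N then p`_i \is (d - i).-homog else p`_i == 0.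

Lemma gradedM d d' p q : graded d p -> graded d' q -> graded (d + d') (p * q).
Proof.
move=> hp hq i; rewrite coefM; case: leqP => hi.
  apply: rpred_sum => -[j hj] _ /=; rewrite ltnS in hj.
  have := hp j; case: leqP => hjd; last by move/eqP ->; rewrite mul0r rpred0.
  have := hq (i - j)%N; case: leqP => hjd'; last by move=> /eqP ->; rewrite mulr0 rpred0.
  move=> h1 h2; have -> : (d + d' - i = (d - j) + (d' - (i - j)))%N by lia.
  exact: dhomogM.
rewrite big1 // => -[j hj] _ /=; rewrite ltnS in hj.
have := hp j; case: leqP => hjd; last by move/eqP ->; rewrite mul0r.
have := hq (i - j)%N; case: leqP => hjd'; last by move=> /eqP ->; rewrite mulr0.
by lia.
Qed.

Lemma gradedX d p e : graded d p -> graded (d * e) (p ^+ e).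
Proof.
move=> hp; elim: e => [|e IH]; last by rewrite exprS mulnS; apply: gradedM.
move=> i; rewrite muln0 expr0 leqn0 coef1; case: eqP => [->|//].
by rewrite subn0 dhomog1.
Qed.

Lemma graded_linear c : c \is 1.-homog -> graded 1 ('X - c%:P).
Proof.
move=> hc [|[|i]]; rewrite coefB coefX coefC /= ?subr0 //.
- by rewrite sub0r rpredN.
- by rewrite dhomog1.
Qed.

Lemma graded_varX : graded 1 ('X : {poly MQ}).
Proof.
move=> [|[|i]]; rewrite coefX //=; [exact: rpred0|exact: dhomog1].
Qed.

Lemma X_homog i : ('X_i : MQ) \is 1.-homog.
Proof. by rewrite dhomogX /= mdeg1. Qed.

Lemma cubic_graded j : graded (3 * m + j) (cubic j m u0 u1 u2).
Proof.
rewrite addnC; apply: gradedM; first by rewrite -[X in graded X]mul1n; apply/gradedX/graded_varX.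
apply: gradedX; rewrite -[3%N]/(1 + 1 + 1)%N.
by do !apply: gradedM; apply: graded_linear; apply: X_homog.
Qed.

Lemma integral_dhomog d p (i : 'I_3) : graded d p -> (primitive p).['X_i] \is d.+1.-homog.
Proof.
move=> hp; rewrite horner_coef; apply: rpred_sum => -[l hl] _ /=.
rewrite coef_poly; case: ltnP => _; last by rewrite mul0r rpred0.
case: l hl => [|l] hl; first by rewrite invr0 !mul0r rpred0.
have -> : (l.+1%:R : MQ)^-1 = (l.+1%:R^-1)%:MP.
  apply: (mulfI (x := l.+1%:R)); first by rewrite -mpolyC_nat mpolyC_eq0 Num.Theory.pnatr_eq0.
  rewrite mulrV; last exact: rational_ring_mpoly.
  by rewrite -mpolyC_nat -mpolyCM mulfV // Num.Theory.pnatr_eq0.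
rewrite -mulrA mul_mpolyC rpredZ //=.
have := hp l; case: leqP => hld; last by move/eqP ->; rewrite mul0r rpred0.
move=> h; have -> : (d.+1 = (d - l) + 1 * l.+1)%N by lia.
by apply: dhomogM => //; apply: dhomogMn; apply: X_homog.
Qed.

Lemma fv_dhomog j (a b : 'I_3) : fv j 'X_a 'X_b \is (3 * m + j).+1.-homog.
Proof. by rewrite fvE rpredB // integral_dhomog //; apply: cubic_graded. Qed.

(** After the common factor $(x_2-x_1)^{2m+1}$ is removed, a single evaluation shows that the
    remaining factor is not zero. *)
Lemma fv_wronsk : wronsk (fv 0 u0 u1) (fv 1 u0 u1) != 0.
Proof.
(* At the point $(0,0,1)$ the reduced integral for $j = 0$ and the integral for $j = 1$ over the
   second side are beta integrals; the reduced integral for $j = 1$ is zero, as $t = 0$ all along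
   the first side. *)
pose v (i : 'I_3) : rat := if i == i2 then 1 else 0.
pose phi := meval v : {rmorphism MQ -> rat}.
have [p0 p1 p2] : [/\ phi u0 = 0, phi u1 = 0 & phi u2 = 1].
  by rewrite /phi /= !mevalXU /v /=.
have rQ := rational_ring_rat; have rA := @rational_ring_mpoly 3.
rewrite /wronsk !cyc_fv !cyc_X !fv_factor; set I0 := integral _ 0 1; set I1 := integral _ 0 1.
have p0I : phi I0 = (-1) ^+ m * integral ('X^m * ('X - 1%:P) ^+ m) 0 1.
  rewrite /I0 rmorph_integral // map_cubic_line /= rmorphB /= p0 p1 p2 subrr rmorph0 rmorph1.
  rewrite -integralZ //; congr (integral _ _ _).
  rewrite /cubic_line /line scale0r addr0 expr0 mul1r sub0r !exprMn mulrC.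
  by rewrite -polyCN -rmorphXn /= mul_polyC.
have p1I : phi I1 = 0.
  rewrite /I1 rmorph_integral // map_cubic_line /= rmorphB /= p0 p1 p2 subrr.
  rewrite /cubic_line /line scale0r addr0 expr1 mul0r /integral.
  rewrite (_ : primitive 0 = 0) ?horner0 ?subrr //.
  by apply/polyP => i; rewrite coef_poly !coef0 mulr0 if_same.
have p1F : phi (fv 1 u1 u2) = integral ('X^(1 + m + m) * ('X - 1%:P) ^+ m) 0 1.
  rewrite !fvE rmorph_integral // map_cubic /= p0 p1 p2; congr (integral _ _ _).
  by rewrite /cubic subr0 !exprMn !mulrA -!exprD.
have e : forall a b c d e : MQ, a * b * c - a * d * e = a * (b * c - d * e).
  by move=> a b c d e; ring.
rewrite e mulf_neq0 ?expf_neq0 ?X_neq //.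
suff : phi (I0 * fv 1 u1 u2 - I1 * fv 0 u1 u2) != 0.
  by apply: contra_neq => ->; rewrite rmorph0.
have nz : phi I0 * phi (fv 1 u1 u2) != 0.
  by rewrite p0I p1F !mulf_neq0 ?beta_neq0 // expf_neq0 // oppr_eq0 oner_eq0.
clear p0I p1F; clearbody phi I0 I1; move: (fv 1 u1 u2) (fv 0 u1 u2) nz => a b nz.
by rewrite rmorphB !rmorphM p1I mul0r subr0.
Qed.
End FelderVeselov.

(** * Existence of $P_k$ and its reduction modulo 3 *)

Section MapMpoly.
Variables (R S : comNzRingType) (phi : {rmorphism R -> S}) (n : nat).
Implicit Types p : {mpoly R[n]}.

Lemma map_msym s p : map_mpoly phi (msym s p) = msym s (map_mpoly phi p).
Proof. by apply/mpolyP => m; rewrite mcoeff_map_mpoly !mcoeff_sym mcoeff_map_mpoly. Qed.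

Lemma map_mpolyXU i : map_mpoly phi 'X_i = 'X_i :> {mpoly S[n]}.
Proof. exact: map_mpolyX. Qed.

Lemma map_collapse (i j : 'I_n) p : map_mpoly phi (collapse i j p) = collapse i j (map_mpoly phi p).
Proof.
elim/mpolyind: p => [|c m p _ _ IH]; first by rewrite /collapse !(rmorph0, comp_mpoly0).
rewrite /collapse !(comp_mpolyD, rmorphD) /= -!/(collapse i j _) IH; congr (_ + _); rewrite /collapse.
rewrite comp_mpolyZ !map_mpolyZ comp_mpolyZ map_mpolyX !comp_mpolyX rmorph_prod; congr (_ *: _).
by apply: eq_bigr => l _; rewrite rmorphXn /= !tnth_mktuple; case: (l == i); rewrite map_mpolyXU.
Qed.

Lemma map_mpoly_inj : injective phi -> injective (map_mpoly phi : {mpoly R[n]} -> {mpoly S[n]}).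
Proof.
move=> inj p q /mpolyP h; apply/mpolyP => m; apply: inj.
by have := h m; rewrite !mcoeff_map_mpoly.
Qed.

Lemma map_dhomog d p : p \is d.-homog -> map_mpoly phi p \is d.-homog.
Proof.
move=> /dhomogP h; apply/dhomogP => m; rewrite mcoeff_msupp mcoeff_map_mpoly => h'.
by apply: h; rewrite mcoeff_msupp; apply: contra_neq h' => ->; rewrite raddf0.
Qed.

Lemma dhomog_map_inj d p : injective phi -> map_mpoly phi p \is d.-homog -> p \is d.-homog.
Proof.
move=> inj /dhomogP h; apply/dhomogP => m; rewrite mcoeff_msupp => h'.
by apply: h; rewrite mcoeff_msupp mcoeff_map_mpoly -(rmorph0 phi) (inj_eq inj).
Qed.
End MapMpoly.

Lemma map_cyc (R S : idomainType) (phi : {rmorphism R -> S}) (p : {mpoly R[3]}) :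
  map_mpoly phi (cyc p) = cyc (map_mpoly phi p).
Proof. by rewrite !cycE map_msym. Qed.

(** In the spirit of Gauss's lemma: as $x_i - x_j$ is monic, divisibility by its powers descends
    along an injective extension of the coefficients. *)
Lemma linear_pow_dvd_map (R S : idomainType) (phi : {rmorphism R -> S}) n (i j : 'I_n)
    e (p : {mpoly R[n]}) q :
  injective phi -> i != j -> map_mpoly phi p = q * ('X_i - 'X_j) ^+ e ->
  exists q0, p = q0 * ('X_i - 'X_j) ^+ e.
Proof.
move=> inj nij; elim: e p q => [|e IH] p q h; first by exists p; rewrite mulr1.
have [a _] := @collapse_eq0 R n i j p nij.
have /a [p1 hp1] : collapse i j p = 0.
  apply: (map_mpoly_inj inj); rewrite rmorph0 map_collapse h exprS !collapseM collapseB !collapseX.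
  by rewrite eqxx eq_sym (negPf nij) subrr mul0r mulr0.
have nl := @mpolyX_sub_neq0 S n i j nij.
have [|q0 hq0] := IH p1 q.
  apply: (mulIf nl); rewrite -mulrA -exprSr -h hp1 rmorphM rmorphB /=.
  by rewrite !map_mpolyXU.
by exists q0; rewrite hp1 hq0 exprSr mulrA.
Qed.

Lemma intr_rat_inj : injective (intr : int -> rat).
Proof. exact: intr_inj. Qed.

Lemma clear_denominators n (p : {mpoly rat[n]}) :
  exists d (P : {mpoly int[n]}), d != 0 /\ map_mpoly intr P = d *: p.
Proof.
pose den := \prod_(m <- msupp p) denq p@_m.
(* The integral coefficient at $m$ is the numerator times the product of all other denominators. *)
exists den%:~R, (\sum_(m <- msupp p)
  (numq p@_m * \prod_(m' <- msupp p | m' != m) denq p@_m') *: 'X_[m]); split.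
  by rewrite intr_eq0 prodf_seq_neq0; apply/allP => m _; rewrite denq_neq0 implybT.
rewrite rmorph_sum /= [in RHS](mpolyE p) scaler_sumr; apply: eq_big_seq => m hm.
rewrite map_mpolyZ map_mpolyX scalerA; congr (_ *: _).
rewrite /den (bigD1_seq m) ?msupp_uniq //= !intrM numqE; ring.
Qed.

Lemma primitive_scale n (P : {mpoly int[n]}) : P != 0 ->
  exists g P', [/\ g != 0, P = g *: P' & forall d : int, (forall m, (d %| P'@_m)%Z) -> `|d|%N = 1%N].
Proof.
move=> P0; pose g := \big[gcdn/0%N]_(m <- msupp P) `|P@_m|%N.
have gP m : (g%:Z %| P@_m)%Z.
  case: (boolP (m \in msupp P)) => [hm|/memN_msupp_eq0 ->]; last exact: dvdz0.
  by rewrite /g (bigD1_seq m) ?msupp_uniq //= dvdzE /= dvdn_gcdl.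
have gd d : (forall m, d %| `|P@_m|)%N -> (d %| g)%N.
  by move=> h; rewrite /g; elim/big_ind: _ => // a b ha hb; rewrite dvdn_gcd ha hb.
have g0 : g%:Z != 0.
  apply: contra_neq P0 => -[g0]; apply/mpolyP => m; rewrite mcoeff0.
  by have := gP m; rewrite g0 dvd0z => /eqP.
pose P' := \sum_(m <- msupp P) (P@_m %/ g)%Z *: 'X_[m].
have PE : P = g%:Z *: P'.
  rewrite [LHS]mpolyE scaler_sumr; apply: eq_bigr => m _.
  by rewrite scalerA mulrC divzK.
exists g%:Z, P'; split => // d hd.
have : (`|d| * g %| g)%N.
  by apply: gd => m; rewrite PE mcoeffZ abszM /= mulnC dvdn_mul //; apply: hd.
rewrite -{2}[g]mul1n dvdn_pmul2r ?dvdn1; first by move/eqP.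
by move: g0; case: (g).
Qed.

(** The Felder--Veselov integral with $j = 0$ is, by the six-generator theorem, a minimal generator
    of the right degree; scaling makes it integral and primitive. *)
Lemma is_P_exists k : exists P, is_P k P.
Proof.
have ed : (3 * k + 1 + (3 * k + 2) = 3 * (2 * k + 1))%N by lia.
pose f := fv k 0 'X_i0 'X_i1; pose g := fv k 1 'X_i0 'X_i1.
have tf : twisted (2 * k + 1) f := fv_twisted k 0.
have tg : twisted (2 * k + 1) g := fv_twisted k 1.
have hf : f \is (3 * k + 1).-homog by rewrite addn1 -[(3 * k)%N]addn0; exact: fv_dhomog.
have hg : g \is (3 * k + 2).-homog by rewrite addn2 -[(3 * k).+1]addn1; exact: fv_dhomog.
have w0 : wronsk f g != 0 := fv_wronsk k.
clearbody f g.
have f0 : f != 0 by apply: contra_neq w0 => ->; rewrite /wronsk cyc0 mul0r mulr0 subrr.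
have [d [P1 [d0 hP1]]] := clear_denominators f.
have P10 : P1 != 0.
  apply: contra_neq f0 => P10; move: hP1; rewrite P10 rmorph0 => /esym /eqP.
  by rewrite scaler_eq0 (negPf d0) => /eqP.
have [e [P [e0 hP prim]]] := primitive_scale P10.
exists (map_mpoly intr P), P; split => //.
pose c : rat := e%:~R^-1 * d.
have c0 : c != 0 by rewrite mulf_neq0 // invr_eq0 intr_eq0.
have PQ : map_mpoly intr P = c *: f :> {mpoly rat[3]}.
  rewrite /c -scalerA -hP1 hP map_mpolyZ scalerA mulVf ?scale1r //.
  by rewrite intr_eq0.
have tP : twisted (2 * k + 1) (c *: f).
  case: tf => sf trf [q hq]; split.
  - by rewrite msymZ sf scalerN.
  - by rewrite !cycZ -!scalerDr trf scaler0.
  - by exists (c *: q); rewrite hq scalerAl.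
have hcf : c *: f \is (3 * k + 1).-homog by rewrite rpredZ.
have w0' : wronsk (c *: f) g != 0.
  by rewrite /wronsk cycZ -scalerAl -scalerAr -scalerBr scaler_eq0 (negPf c0).
have cf0 : c *: f != 0 by rewrite scaler_eq0 (negPf c0).
rewrite /is_Pbar PQ; split => //; last by case: tP.
- have n2 : 2%:R != 0 :> rat by [].
  have n3 : 3%:R != 0 :> rat by [].
  apply: (free_minimal_generator (six_generators_free n2 n3 tP tg hcf hg ed w0')) => //.
  + have hm d' p : p \is d'.-homog -> mirror p \is d'.-homog.
      by move=> hp; rewrite mirrorE rpredB // !cyc_dhomog.
    move=> h; rewrite !inE => /or4P [/eqP ->|/eqP ->|/eqP ->|].
    * by exists 0%N; exact: dhomog1.
    * by eexists; apply: dhomogMn; exact: vdm_dhomog.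
    * by eexists; exact: hcf.
    case/or3P => /eqP ->; eexists.
    * exact: hm hcf.
    * exact: hg.
    * exact: hm hg.
  + by rewrite !inE eqxx !orbT.
- by rewrite /degree (dhomog_msizeE cf0 hcf).
Qed.

Lemma intr_F3_eq0 (x : int) : (x%:~R : 'F_3) = 0 -> (3 %| x)%Z.
Proof.
move=> h; rewrite dvdzE /= (dvdn_pcharf (pchar_Fp (isT : prime 3))).
case: x h => n /= h; first by apply/eqP.
by apply/eqP; move: h; rewrite NegzE mulrNz => /eqP; rewrite oppr_eq0 => /eqP.
Qed.

(** Over the rationals the degree $3k+1$ is below $6k+3$, so the trace vanishes; each of the three
    conditions then descends to integer coefficients and passes to the quotient modulo 3. *)
Lemma is_P_twisted k P : is_P k P ->
  [/\ twisted (2 * k + 1) P, P \is (3 * k + 1).-homog & P != 0].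
Proof.
case=> Pb [[]] gen deg anti prim ->.
set PQ := map_mpoly intr Pb in gen deg anti.
have n2 : 2%:R != 0 :> rat by [].
have [S [[gS hS] _ PS]] := gen.
have PQ0 : PQ != 0.
  by apply/eqP => h; move: deg; rewrite h /degree msize0; lia.
have hQ : PQ \is (3 * k + 1).-homog.
  have [d hd] := hS _ PS; have := deg; rewrite /degree (dhomog_msizeE PQ0 hd) /=.
  by move=> <-.
have qQ : quasi_invariant k PQ.
  by rewrite -(nth_index 0 PS); apply: generates_mem gS _; rewrite index_mem.
have [sQ trQ [q hq]] := quasi_twisted n2 qQ anti hQ (ltac:(lia) : (3 * k + 1 < 6 * k + 3)%N).
have inj := @map_mpoly_inj _ _ (intr : {rmorphism int -> rat}) 3 intr_rat_inj.
split.
- split.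
  + rewrite -map_msym -rmorphN /=; congr (map_mpoly _ _); apply: inj.
    by rewrite /= rmorphN /= map_msym.
  + rewrite -!map_cyc -!rmorphD /=.
    have -> : Pb + cyc Pb + cyc (cyc Pb) = 0.
      by apply: inj; rewrite /= !rmorphD /= !map_cyc rmorph0.
    by rewrite rmorph0.
  + have [||q0 hq0] := @linear_pow_dvd_map int rat intr 3 0 1 (2 * k + 1) Pb q intr_rat_inj.
    * by [].
    * exact: hq.
    by exists (map_mpoly intr q0); rewrite {1}hq0 rmorphM rmorphXn rmorphB /= !map_mpolyXU.
- exact/map_dhomog/(dhomog_map_inj intr_rat_inj hQ).
(* A primitive polynomial does not reduce to zero: otherwise 3 would divide every coefficient. *)
apply/eqP => /mpolyP h; suff : `|3|%N = 1%N by [].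
apply: prim => m; apply: intr_F3_eq0.
by have := h m; rewrite mcoeff_map_mpoly mcoeff0.
Qed.

(** * The one-variable model over $\mathbf{F}_3$ *)

Local Notation k := ('F_3).
Local Notation MP := {mpoly 'F_3[3]}.
Local Notation x0 := ('X_i0 : MP).
Local Notation x1 := ('X_i1 : MP).
Local Notation x2 := ('X_i2 : MP).

(** The 3-cycle in the coordinate $X = x_1-x_2$ on the plane $x_1+x_2+x_3 = 1$. *)
HB.lock Definition shift (F : {poly k}) := F \Po ('X - 1).
(** The transposition $s_{12}$ in the same coordinate. *)
HB.lock Definition flip (F : {poly k}) := F \Po (- 'X).

Section UnivariateF3.
Implicit Types F G p q : {poly k}.

Lemma shiftE F : shift F = F \Po ('X - 1). Proof. by rewrite shift.unlock. Qed.
Lemma flipE F : flip F = F \Po (- 'X). Proof. by rewrite flip.unlock. Qed.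
Lemma shiftM F G : shift (F * G) = shift F * shift G. Proof. by rewrite !shiftE rmorphM. Qed.
Lemma shiftN F : shift (- F) = - shift F. Proof. by rewrite !shiftE rmorphN. Qed.
Lemma shiftB F G : shift (F - G) = shift F - shift G. Proof. by rewrite !shiftE rmorphB. Qed.
Lemma shiftXn F n : shift (F ^+ n) = shift F ^+ n. Proof. by rewrite !shiftE rmorphXn. Qed.
Lemma shiftZ c F : shift (c *: F) = c *: shift F. Proof. by rewrite !shiftE comp_polyZ. Qed.
Lemma shiftX : shift 'X = 'X - 1. Proof. by rewrite !shiftE comp_polyX. Qed.
Lemma shift0 : shift 0 = 0. Proof. by rewrite !shiftE rmorph0. Qed.
Lemma shift1 : shift 1 = 1. Proof. by rewrite !shiftE rmorph1. Qed.
Lemma flipM F G : flip (F * G) = flip F * flip G. Proof. by rewrite !flipE rmorphM. Qed.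
Lemma flipB F G : flip (F - G) = flip F - flip G. Proof. by rewrite !flipE rmorphB. Qed.
Lemma flipXn F n : flip (F ^+ n) = flip F ^+ n. Proof. by rewrite !flipE rmorphXn. Qed.
Lemma flipZ c F : flip (c *: F) = c *: flip F. Proof. by rewrite !flipE comp_polyZ. Qed.
Lemma flipX : flip 'X = - 'X. Proof. by rewrite !flipE comp_polyX. Qed.

Lemma F3_three0 : 3%:R = 0 :> k. Proof. by apply/val_inj. Qed.
Lemma polyF3_three0 : 3%:R = 0 :> {poly k}.
Proof. by rewrite -polyC_natr F3_three0. Qed.

Lemma size_X1 : size ('X - 1 : {poly k}) = 2%N.
Proof. by rewrite -[1]polyC1 size_XsubC. Qed.

Lemma horner_shift F x : (shift F).[x] = F.[x - 1].
Proof. by rewrite shiftE horner_comp hornerD hornerX hornerN -[1]polyC1 hornerC. Qed.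
Lemma horner_flip F x : (flip F).[x] = F.[- x].
Proof. by rewrite flipE horner_comp hornerN hornerX. Qed.

Lemma comp_polyN p q : (- p) \Po q = - (p \Po q).
Proof. exact: rmorphN. Qed.
Lemma comp_poly1 q : 1 \Po q = 1.
Proof. exact: rmorph1. Qed.

Lemma shift3 F : shift (shift (shift F)) = F.
Proof.
rewrite !shiftE -!comp_polyA !(comp_polyB, comp_polyX, comp_poly1).
have -> : 'X - 1 - 1 - 1 = 'X - 3%:R :> {poly k} by ring.
by rewrite polyF3_three0 subr0 comp_polyXr.
Qed.

Lemma flip_shift F : flip (shift F) = shift (shift (flip F)).
Proof.
rewrite !shiftE !flipE -!comp_polyA !(comp_polyB, comp_polyN, comp_polyX, comp_poly1).
congr (F \Po _); have -> : - ('X - 1 - 1) = - 'X - 1 + 3%:R :> {poly k} by ring.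
by rewrite polyF3_three0 addr0.
Qed.

Lemma size_shift F : size (shift F) = size F.
Proof. by rewrite shiftE size_comp_poly2 // size_X1. Qed.
Lemma size_flip F : size (flip F) = size F.
Proof. by rewrite flipE size_comp_poly2 // size_polyN size_polyX. Qed.

Lemma deriv_shift F : (shift F)^`() = shift F^`().
Proof. by rewrite !shiftE deriv_comp derivB derivX -[1 in X in _ * X]polyC1 derivC subr0 mulr1. Qed.

Lemma lead_shift F : lead_coef (shift F) = lead_coef F.
Proof.
rewrite shiftE lead_coef_comp ?size_X1 //.
by rewrite -[1]polyC1 lead_coefXsubC expr1n mulr1.
Qed.

(** The restriction of the Vandermonde polynomial, up to sign: the product of the mirror equations
    $X$, $X-1$, $X+1$. *)
Definition vdm1 : {poly k} := 'X ^+ 3 - 'X.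

Lemma shift_vdm1 : shift vdm1 = vdm1.
Proof.
rewrite /vdm1 shiftB shiftXn shiftX.
have -> : ('X - 1) ^+ 3 - ('X - 1) = ('X ^+ 3 - 'X) + 3%:R * ('X - 'X ^+ 2) :> {poly k} by ring.
by rewrite polyF3_three0 mul0r addr0.
Qed.
Lemma flip_vdm1 : flip vdm1 = - vdm1.
Proof. by rewrite /vdm1 flipB flipXn flipX; ring. Qed.
Lemma size_vdm1 : size vdm1 = 4%N.
Proof. by rewrite /vdm1 size_polyDl ?size_polyXn // size_polyN size_polyX. Qed.
Lemma vdm1_neq0 : vdm1 != 0. Proof. by rewrite -size_poly_eq0 size_vdm1. Qed.
Lemma vdm1E : vdm1 = 'X * (('X - 1) * ('X + 1)).
Proof. by rewrite /vdm1; ring. Qed.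

(** The restrictions of twisted polynomials for the exponent $2m+1$. *)
Definition odd_traceless m F := [/\ flip F = - F, F + shift F + shift (shift F) = 0 & 'X^(2 * m + 1) %| F].

Definition shift_wronsk F G := F * shift G - G * shift F.

Lemma trace_shift2 F : F + shift F + shift (shift F) = 0 -> shift (shift F) = - F - shift F.
Proof. by move=> h; apply/eqP; rewrite -subr_eq0 -h; apply/eqP; ring. Qed.

Lemma shift2_trace F : shift (shift F) = - F - shift F -> F + shift F + shift (shift F) = 0.
Proof. by move=> ->; ring. Qed.

Lemma even_dvd F : flip F = F -> F.[0] = 0 -> 'X^2 %| F.
Proof.
move=> eF /eqP; rewrite -/(root F 0) -dvdp_XsubCl subr0 => /dvdpP [q hq].
rewrite hq expr2 dvdp_mul2r ?polyX_eq0 // -['X]subr0 -polyC0 dvdp_XsubCl /root.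
have hq' : flip q = - q.
  apply: (mulIf (negbT (polyX_eq0 k))).
  by move: eF; rewrite hq flipM flipX mulrN mulNr => <-; rewrite opprK.
have : q.[0] = - q.[0] by rewrite -hornerN -hq' horner_flip oppr0.
by move/eqP; rewrite -addr_eq0 -mulr2n -mulr_natr mulf_eq0 orbF.
Qed.

(** An odd polynomial has odd order at $0$, so cancelling one coefficient raises the order by 2. *)
Lemma odd_traceless_lift m F q : odd_traceless m F -> F = q * 'X^(2 * m + 1) -> q.[0] = 0 -> odd_traceless m.+1 F.
Proof.
case=> oF tF _ hF q0; split=> //.
have eq : flip q = q.
  apply: (mulIf (expf_neq0 (2 * m + 1) (negbT (polyX_eq0 k)))).
  have := oF; rewrite hF flipM flipXn flipX exprNn -signr_odd oddD oddM /= expr1 => h.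
  by apply: oppr_inj; rewrite -h; ring.
have -> : (2 * m.+1 + 1 = 2 + (2 * m + 1))%N by lia.
by rewrite hF exprD dvdp_mul2r ?even_dvd // expf_neq0 // polyX_eq0.
Qed.

Lemma odd_traceless_vdm1_sq m F : odd_traceless m F -> odd_traceless m.+1 (vdm1 ^+ 2 * F).
Proof.
case=> oF tF dF; split.
- by rewrite flipM flipXn flip_vdm1 oF; ring.
- by rewrite !(shiftM (vdm1 ^+ 2), shiftXn vdm1) shift_vdm1 !(shiftM (vdm1 ^+ 2)) shiftXn shift_vdm1 -!mulrDr tF mulr0.
- have -> : (2 * m.+1 + 1 = 2 + (2 * m + 1))%N by lia.
  rewrite exprD dvdp_mul // vdm1E exprMn dvdp_mulr //.
Qed.

Lemma odd_traceless_sub m c F G : odd_traceless m F -> odd_traceless m G -> odd_traceless m (G - c *: F).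
Proof.
case=> oF tF dF [oG tG dG]; split.
- by rewrite flipB flipZ oF oG scalerN; ring.
- apply: shift2_trace; rewrite !shiftB !shiftZ (trace_shift2 tF) (trace_shift2 tG) scalerBr scalerN.
  by move: (c *: F) (c *: shift F) => a b; ring.
- by rewrite dvdp_sub // -mul_polyC dvdp_mull.
Qed.

Lemma size_vdm1_sqM p : p != 0 -> size (vdm1 ^+ 2 * p) = (size p + 6)%N.
Proof.
move=> p0; rewrite size_mul ?expf_neq0 ?vdm1_neq0 // expr2 size_mul ?vdm1_neq0 // size_vdm1.
by move: p0; rewrite -size_poly_eq0; case: (size p) => // n _; lia.
Qed.

(** The one-variable counterpart of a basis; the degrees sum to at most $6m+4$, one more than the
    least value in three variables. *)
Lemma odd_traceless_basis m : exists F G, [/\ odd_traceless m F, odd_traceless m G, shift_wronsk F G != 0, (size F <= size G)%N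
  & (size F + size G <= 6 * m + 6)%N].
Proof.
suff [F [G [pF pG w s]]] : exists F G, [/\ odd_traceless m F, odd_traceless m G, shift_wronsk F G != 0
    & (size F + size G <= 6 * m + 6)%N].
  case: (leqP (size F) (size G)) => h; first by exists F, G.
  exists G, F; split => //; [|exact: ltnW|by rewrite addnC].
  by have -> : shift_wronsk G F = - shift_wronsk F G by [rewrite /shift_wronsk; ring]; rewrite oppr_eq0.
elim: m => [|m [F [G [pF pG w s]]]].
  exists 'X, vdm1; split; last by rewrite size_polyX size_vdm1.
  - split=> //; first exact: flipX.
    rewrite !(shiftX, shiftB, shift1); have -> : 'X + ('X - 1) + ('X - 1 - 1) = 3%:R * ('X - 1) :> {poly k} by ring.
    by rewrite polyF3_three0 mul0r.
  - split; [exact: flip_vdm1| |by rewrite vdm1E dvdp_mulr].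
    rewrite !shift_vdm1; have -> : vdm1 + vdm1 + vdm1 = 3%:R * vdm1 by ring.
    by rewrite polyF3_three0 mul0r.
  rewrite /shift_wronsk shiftX shift_vdm1; have -> : 'X * vdm1 - vdm1 * ('X - 1) = vdm1 by ring.
  exact: vdm1_neq0.
wlog le : F G pF pG w s / (size F <= size G)%N.
  move=> H; case: (leqP (size F) (size G)) => h; first exact: (H F G).
  apply: (H G F) => //; [|by rewrite addnC|exact: ltnW].
  by have -> : shift_wronsk G F = - shift_wronsk F G by [rewrite /shift_wronsk; ring]; rewrite oppr_eq0.
have sD := size_vdm1_sqM.
have F0 : F != 0 by apply: contra_neq w => ->; rewrite /shift_wronsk shift0 !(mul0r, mulr0) subrr.
have G0 : G != 0 by apply: contra_neq w => ->; rewrite /shift_wronsk shift0 !(mul0r, mulr0) subrr.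
have wD p q : shift_wronsk p (vdm1 ^+ 2 * q) = vdm1 ^+ 2 * shift_wronsk p q.
  by rewrite /shift_wronsk shiftM shiftXn shift_vdm1; ring.
have D2 : vdm1 ^+ 2 != 0 by rewrite expf_neq0 ?vdm1_neq0.
have [_ _ /dvdpP [F1 hF]] := pF; have [_ _ /dvdpP [G1 hG]] := pG.
(* Some combination of $F$ and $G$ loses its lowest coefficient; since orders at $0$ are odd it then
   lies in the next module. The other generator is pushed there by $(X^3-X)^2$, so the sum of the
   degrees grows by at most $6$: eliminating from the longer polynomial does not enlarge it. *)
have [a0|a0] := eqVneq F1.[0] 0.
  exists F, (vdm1 ^+ 2 * G); split; [exact: odd_traceless_lift hF a0|exact: odd_traceless_vdm1_sq| |].
    by rewrite wD mulf_neq0.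
  by rewrite sD //; lia.
exists (G - (G1.[0] / F1.[0]) *: F), (vdm1 ^+ 2 * F); split.
- apply: (@odd_traceless_lift _ _ (G1 - (G1.[0] / F1.[0]) *: F1)); first exact: odd_traceless_sub.
    by rewrite {1}hG {1}hF scalerAl -mulrBl.
  by rewrite hornerD hornerN hornerZ divfK // subrr.
- exact: odd_traceless_vdm1_sq.
- rewrite wD mulf_neq0 //; have -> : shift_wronsk (G - (G1.[0] / F1.[0]) *: F) F = - shift_wronsk F G.
    by rewrite /shift_wronsk shiftB shiftZ mulrBl mulrBr -scalerAl -scalerAr; ring.
  by rewrite oppr_eq0.
- rewrite sD //; have : (size (G - (G1.[0] / F1.[0]) *: F)%R <= size G)%N.
    apply: leq_trans (size_polyD _ _) _; rewrite geq_max leqnn size_polyN.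
    by apply: leq_trans (size_scale_leq _ _) le.
  lia.
Qed.

(** * Descent for one-variable solutions of low degree *)

Lemma cube_add (A : comNzRingType) (a b : A) : 3%:R = 0 :> A -> (a + b) ^+ 3 = a ^+ 3 + b ^+ 3.
Proof.
move=> A3; have -> : (a + b) ^+ 3 = a ^+ 3 + b ^+ 3 + 3%:R * (a ^+ 2 * b + a * b ^+ 2) by ring.
by rewrite A3 mul0r addr0.
Qed.

Lemma cube_inj (A : idomainType) (a b : A) : 3%:R = 0 :> A -> a ^+ 3 = b ^+ 3 -> a = b.
Proof.
move=> A3 h; apply/eqP; rewrite -subr_eq0 -[_ == 0](expf_eq0 _ 3) cube_add //.
by rewrite -[in X in _ + X]mulN1r exprMn h -signr_odd expr1 mulN1r subrr.
Qed.

Lemma poly_cube p : p ^+ 3 = p \Po 'X^3.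
Proof.
elim/poly_ind: p => [|p c IH]; first by rewrite comp_poly0 expr0n.
rewrite cube_add ?polyF3_three0 // comp_polyD comp_polyM comp_polyX comp_polyC exprMn IH.
have c3 : c ^+ 3 = c by have := expf_card c; rewrite card_Fp.
by rewrite -rmorphXn /= c3.
Qed.

(** Only exponents divisible by 3 survive, and cubing fixes the coefficients in $\mathbf{F}_3$. *)
Lemma deriv0_cube F : F^`() = 0 -> exists G, F = G ^+ 3.
Proof.
move=> dF; exists (\poly_(i < size F) F`_(3 * i)).
apply/polyP => i; rewrite poly_cube coef_comp_poly_Xn // coef_poly.
case: ifPn => [/dvdnP [j ->]|hi].
  rewrite mulnK // mulnC; case: ltnP => // h; apply: nth_default.
  by apply: leq_trans h _; rewrite leq_pmull.
case: i hi => // i hi; have := congr1 (fun p : {poly k} => p`_i) dF.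
rewrite coef_deriv coef0 -mulr_natr => /eqP; rewrite mulf_eq0 => /orP [/eqP //|].
by rewrite -(dvdn_pcharf (pchar_Fp (isT : prime 3))) (negPf hi).
Qed.

Lemma coprime_shifts n m l :
  [/\ coprimep ('X^n : {poly k}) (('X - 1) ^+ m), coprimep ('X^n : {poly k}) (('X + 1) ^+ l)
   & coprimep (('X - 1) ^+ m : {poly k}) (('X + 1) ^+ l)].
Proof.
have e2 : 'X + 1 = 'X - (-1)%:P :> {poly k} by rewrite polyCN opprK.
have c1 : coprimep ('X : {poly k}) ('X - 1) by rewrite -polyC1 coprimep_XsubC /root hornerX.
have c2 : coprimep ('X : {poly k}) ('X + 1) by rewrite e2 coprimep_XsubC /root hornerX.
have c3 : coprimep ('X - 1 : {poly k}) ('X + 1).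
  by rewrite e2 coprimep_XsubC /root -polyC1 hornerXsubC.
by split; rewrite coprimep_expl // coprimep_expr.
Qed.

(** A shift-invariant polynomial has the same order at all three points of $\mathbf{F}_3$. *)
Lemma shift_dvd n W : shift W = W -> 'X^n %| W -> vdm1 ^+ n %| W.
Proof.
move=> sW d0; have [c1 c2 c3] := coprime_shifts n n n.
have dvd_sh p q : p %| q -> shift p %| shift q by rewrite !shiftE; apply: dvdp_comp_poly.
have d1 : ('X - 1) ^+ n %| W by rewrite -sW -shiftX -shiftXn; apply: dvd_sh.
have d2 : ('X + 1) ^+ n %| W.
  have -> : 'X + 1 = shift (shift 'X).
    rewrite shiftX shiftB shiftX shift1; have -> : 'X + 1 = 'X - 1 - 1 + 3%:R :> {poly k} by ring.
    by rewrite polyF3_three0 addr0.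
  by rewrite -sW -[in X in _ %| X]sW -!shiftXn; exact: (dvd_sh _ _ (dvd_sh _ _ d0)).
rewrite vdm1E !exprMn Gauss_dvdp; last by rewrite coprimepMr c1 c2.
by rewrite d0 Gauss_dvdp // d1 d2.
Qed.

Lemma vdm1_root_dvd p : p.[0] = 0 -> p.[1] = 0 -> p.[-1] = 0 -> vdm1 %| p.
Proof.
move=> h0 h1 h2; rewrite vdm1E.
have [c1 c2 c3] := coprime_shifts 1 1 1; rewrite !expr1 in c1 c2 c3.
rewrite Gauss_dvdp; last by rewrite coprimepMr c1 c2.
rewrite Gauss_dvdp // -['X]subr0 -polyC0 dvdp_XsubCl /root h0 eqxx subr0 -{1}polyC1.
by rewrite dvdp_XsubCl /root h1 eqxx -[1]opprK -polyC1 -polyCN dvdp_XsubCl /root h2 eqxx.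
Qed.

Lemma F3_m1m1 : - 1 - 1 = 1 :> k. Proof. exact/val_inj. Qed.

(** Vanishing at $1$ propagates by oddness and trace zero to all of $\mathbf{F}_3$. The first
    quotient by $X^3-X$ is even and of trace zero, and $m > 0$ makes it vanish at $0$; so it
    vanishes at $\pm1$ too, and a second factor comes out. *)
Lemma odd_traceless_div_vdm1_sq m F : (0 < m)%N -> odd_traceless m F -> F.[1] = 0 ->
  exists2 F1, odd_traceless m.-1 F1 & F = vdm1 ^+ 2 * F1.
Proof.
case: m => // m _ [oF tF dF] F1.
have Fm1 : F.[-1] = 0 by rewrite -horner_flip oF hornerN F1 oppr0.
have F0 : F.[0] = 0.
  by have := congr1 (horner^~ 0) tF; rewrite !hornerD !horner_shift horner0 => h; move: h; rewrite sub0r Fm1 F3_m1m1 F1 !addr0.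
have /dvdpP [E hE] := vdm1_root_dvd F0 F1 Fm1.
have eE : flip E = E.
  by apply: (mulIf vdm1_neq0); move: oF; rewrite hE flipM flip_vdm1 mulrN => /oppr_inj.
have tE : E + shift E + shift (shift E) = 0.
  by apply: (mulIf vdm1_neq0); rewrite mul0r -tF hE !shiftM !shift_vdm1 !mulrDl.
have dE : 'X^(2 * m + 2) %| E.
  have [c1 c2 _] := coprime_shifts (2 * m + 2) 1 1.
  rewrite !expr1 in c1 c2.
  have := dF; rewrite hE mulrC vdm1E -mulrA (_ : (2 * m.+1 + 1 = (2 * m + 2).+1)%N); last by lia.
  by rewrite exprS dvdp_mul2l ?polyX_eq0 // Gauss_dvdpr // coprimepMr c1 c2.
have E0 : E.[0] = 0.
  by have /dvdpP [q ->] := dE; rewrite hornerM hornerXn expr0n addn2 mulr0.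
have Em1 : E.[-1] = E.[1] by rewrite -horner_flip eE.
have E1 : E.[1] = 0.
  have := congr1 (horner^~ 0) tE; rewrite !hornerD !horner_shift horner0 sub0r Em1 F3_m1m1 E0 add0r.
  by move/eqP; rewrite -mulr2n -mulr_natr mulf_eq0 orbF => /eqP.
have /dvdpP [F2 hF2] := vdm1_root_dvd E0 E1 (etrans Em1 E1).
exists F2; last by rewrite hE hF2; ring.
split.
- by apply: (mulIf vdm1_neq0); move: eE; rewrite hF2 flipM flip_vdm1 mulrN mulNr => <-; rewrite opprK.
- by apply: (mulIf vdm1_neq0); rewrite mul0r -tE hF2 !shiftM !shift_vdm1 !mulrDl.
- have [c1 c2 _] := coprime_shifts (2 * m + 1) 1 1.
  rewrite !expr1 in c1 c2.
  have := dE; rewrite hF2 mulrC vdm1E -mulrA (_ : (2 * m + 2 = (2 * m + 1).+1)%N); last by lia.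
  by rewrite exprS dvdp_mul2l ?polyX_eq0 // Gauss_dvdpr // coprimepMr c1 c2.
Qed.

(** The derivative commutes with the shift, so it is again of trace zero and the wronskian of $F$
    and $F'$ is shift invariant. It vanishes to order $2m$ at $0$, hence is divisible by
    $(X^3-X)^{2m}$, whose degree $6m$ exceeds $2\deg F - 1$. *)
Lemma odd_traceless_deriv_wronsk m F : odd_traceless m F -> F != 0 -> (size F <= 3 * m + 1)%N ->
  F * shift F^`() = F^`() * shift F.
Proof.
case=> oF tF dF F0 sF.
have tdF : F^`() + shift F^`() + shift (shift F^`()) = 0.
  by rewrite -!deriv_shift -!derivD tF derivC.
pose W := F * shift F^`() - F^`() * shift F.
have sW : shift W = W.
  by rewrite /W shiftB !shiftM (trace_shift2 tF) (trace_shift2 tdF); ring.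
have dW : 'X^(2 * m) %| W.
  have /dvdpP [q hq] := dF.
  have d1 : 'X^(2 * m) %| F.
    by apply: dvdp_trans dF; rewrite dvdp_exp2l // leq_addr.
  have d2 : 'X^(2 * m) %| F^`().
    rewrite hq derivM derivXn addn1 /= dvdp_add //.
      by rewrite exprS mulrA dvdp_mull.
    by rewrite -mulr_natr dvdp_mull // dvdp_mulr.
  by rewrite dvdp_sub // dvdp_mulr.
apply/eqP; rewrite -subr_eq0 -/W; apply: contraT => W0.
have := dvdp_leq W0 (shift_dvd sW dW).
have s1 : (0 < size F)%N by rewrite lt0n size_poly_eq0.
have sd : (size F^`() < size F)%N by apply: lt_size_deriv.
have sD : size (vdm1 ^+ (2 * m)) = (6 * m + 1)%N.
  have := size_exp vdm1 (2 * m); rewrite size_vdm1.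
  have : (0 < size (vdm1 ^+ (2 * m)))%N by rewrite lt0n size_poly_eq0 expf_neq0 ?vdm1_neq0.
  by move: (size (vdm1 ^+ (2 * m))) => s; lia.
have sP : (size (F * shift F^`())%R <= (size F + size F^`()).-1)%N.
  by apply: leq_trans (size_polyMleq _ _) _; rewrite size_shift.
have sP' : (size (F^`() * shift F)%R <= (size F + size F^`()).-1)%N.
  by apply: leq_trans (size_polyMleq _ _) _; rewrite size_shift addnC.
have sWb : (size W <= (size F + size F^`()).-1)%N.
  by apply: leq_trans (size_polyD _ _) _; rewrite size_polyN geq_max sP sP'.
rewrite sD; move: sWb sd sF s1; move: (size W) (size F^`()) (size F) => a b c; lia.
Qed.

Lemma eqp_lead_eq (p q : {poly k}) : p != 0 -> q %= p -> lead_coef q = lead_coef p -> q = p.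
Proof.
move=> p0 /eqpP [[a b] /= /andP [a0 b0] h] l.
have : a = b.
  have := congr1 lead_coef h; rewrite !lead_coefZ l => /(mulIf _); apply.
  by rewrite lead_coef_eq0.
by move=> ab; move: h; rewrite ab => /(scalerI b0).
Qed.

Lemma cube_size_arith a b c : (0 < b)%N -> (0 < a)%N -> b.-1 = (c.-1 * 3)%N ->
  (3 * c.-1 < (b + a).-1)%N.
Proof. lia. Qed.

(** Let $h = \gcd(F(X), F(X-1))$. It divides all three shifts of $F$, so it is shift invariant and
    even, and $F/h$ is coprime to its own shift. The vanishing wronskian makes $F/h$ divide its
    derivative times that shift, so the derivative is zero and $F/h$ is a cube $G^3$. Oddness and
    trace zero pass to the cube root because cubing is additive and injective. *)
Lemma odd_traceless_cube m F : odd_traceless m F -> F != 0 -> (size F <= 3 * m + 1)%N -> F.[1] != 0 ->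
  exists G, [/\ flip G = - G, G + shift G + shift (shift G) = 0, 'X^(2 * m + 1) %| G ^+ 3, G != 0
     & (3 * (size G).-1 < size F)%N].
Proof.
move=> pF F0 sF F1; have E1 := odd_traceless_deriv_wronsk pF F0 sF.
case: pF => oF tF dF.
pose h := gcdp F (shift F).
have h0 : h != 0 by rewrite gcdp_eq0 negb_and F0.
have hF : h %| F := dvdp_gcdl _ _.
have hsF : h %| shift F := dvdp_gcdr _ _.
have hssF : h %| shift (shift F) by rewrite (trace_shift2 tF) dvdp_sub // dvdpNr.
have dvd_sh p q : p %| q -> shift p %| shift q by rewrite !shiftE; apply: dvdp_comp_poly.
have dvd_flip p q : p %| q -> flip p %| flip q by rewrite !flipE; apply: dvdp_comp_poly.
have shh : shift h = h.
  apply: eqp_lead_eq => //; last exact: lead_shift.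
  rewrite -dvdp_size_eqp ?size_shift // dvdp_gcd andbC; apply/andP; split; first exact: dvd_sh.
  have := dvd_sh _ _ hsF; have := dvd_sh _ _ hssF; rewrite shift3 //.
(* $F(-1) = -F(1) \ne 0$, so $0$ is not a common root of $F$ and its shift. *)
have h00 : h.[0] != 0.
  apply: contraNneq F1 => hh; have : root h 0 by apply/eqP.
  rewrite root_gcd => /andP [/eqP r0 /eqP]; rewrite horner_shift sub0r => r1.
  by rewrite -[1]opprK -horner_flip oF hornerN r1 oppr0.
have fh : flip h = h.
  have : flip h %= h.
    rewrite -dvdp_size_eqp ?size_flip // dvdp_gcd.
    have d1 : flip h %| F by have := dvd_flip _ _ hF; rewrite oF dvdpNr.
    have d2 : flip h %| shift (shift F) by have := dvd_flip _ _ hsF; rewrite flip_shift oF !shiftN dvdpNr.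
    rewrite d1 /=; have -> : shift F = - F - shift (shift F) by rewrite (trace_shift2 tF); ring.
    by rewrite dvdp_sub // dvdpNr.
  move=> /eqpP [[a b] /= /andP [a0 b0] e].
  have := congr1 (horner^~ 0) e; rewrite /= !hornerZ horner_flip oppr0 => /(mulIf h00) ab.
  by move: e; rewrite ab => /(scalerI b0).
have /dvdpP [F2 hF2] := hF; have /dvdpP [B2 hB2] := hsF.
have shF2 : shift F2 = B2 by apply: (mulIf h0); rewrite -hB2 hF2 shiftM shh.
have cop : coprimep F2 B2.
  have := @coprimep_div_gcd _ F (shift F); rewrite F0 => /(_ isT).
  by rewrite -/h {1}hF2 {1}hB2 !mulpK.
have F20 : F2 != 0 by apply: contra_neq F0 => e; rewrite hF2 e mul0r.
have dF2 : F2^`() = 0.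
  (* Dividing both entries of a wronskian by $h$ divides it by $h^2$. *)
  have E2 : F2 * B2^`() = F2^`() * B2.
    have h2 : h * h != 0 by rewrite mulf_neq0.
    apply: (mulIf h2); apply/eqP; rewrite -subr_eq0; apply/eqP.
    move/eqP: E1; rewrite -subr_eq0 => /eqP <-.
    rewrite -deriv_shift hB2 [in RHS]hF2 !derivM.
    by ring.
  apply/eqP; apply: contraT => d0.
  have : F2 %| F2^`() * B2 by rewrite -E2 dvdp_mulr.
  rewrite Gauss_dvdpl // => /(dvdp_leq d0); rewrite leqNgt lt_size_deriv //.
have [G hG] := deriv0_cube dF2.
have fF2 : flip F2 = - F2.
  by apply: (mulIf h0); rewrite mulNr -hF2 -oF hF2 flipM fh.
have tF2 : F2 + shift F2 + shift (shift F2) = 0.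
  by apply: (mulIf h0); rewrite mul0r -tF hF2 !shiftM !shh !mulrDl.
have G0 : G != 0 by apply: contra_neq F20 => e; rewrite hG e expr0n.
have p3 := polyF3_three0.
exists G; split => //.
- apply: (cube_inj p3); rewrite -flipXn -hG fF2 hG.
  by rewrite -[in RHS]mulN1r exprMn -signr_odd expr1 mulN1r.
- apply: (cube_inj p3); rewrite !cube_add // -!shiftXn -hG tF2 expr0n //.
- have := dF; rewrite hF2 hG Gauss_dvdpl // coprimep_expl // coprimep_sym.
  by rewrite coprimepX.
rewrite hF2 size_mul // hG; have := size_exp G 3.
have : (0 < size h)%N by rewrite lt0n size_poly_eq0.
have : (0 < size (G ^+ 3))%N by rewrite lt0n size_poly_eq0 expf_neq0.
by move: (size h) (size (G ^+ 3)) (size G); exact: cube_size_arith.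
Qed.

(** The cube root $G$ solves the same problem, for the $l$ given by its exact order $2l+1$ at $0$.
    *)
Lemma odd_traceless_order G : flip G = - G -> G + shift G + shift (shift G) = 0 -> G != 0 ->
  exists2 l, odd_traceless l G & forall n, 'X^n %| G ^+ 3 -> (n <= 3 * (2 * l + 1))%N.
Proof.
move=> oG tG G0; have [o [q]] := multiplicity_XsubC G 0.
rewrite G0 subr0 /= => q0 hq.
have oo : odd o.
  apply: contraT => /negPf eo; move: q0; rewrite /root.
  have : flip q = - q.
    apply: (mulIf (expf_neq0 o (negbT (polyX_eq0 k)))); rewrite mulNr -hq -oG hq flipM flipXn flipX.
    by rewrite exprNn -signr_odd eo expr0 mul1r.
  move=> /(congr1 (horner^~ 0)); rewrite /= horner_flip hornerN oppr0 => /eqP.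
  by rewrite -addr_eq0 -mulr2n -mulr_natr mulf_eq0 orbF => ->.
(* The order $o$ of vanishing at $0$ is odd because $G$ is. *)
exists o./2; first split => //.
  by rewrite hq (_ : (2 * o./2 + 1 = o)%N) ?dvdp_mull //; lia.
move=> n; rewrite hq exprMn -exprM.
have -> : (3 * (2 * o./2 + 1) = o * 3)%N by lia.
rewrite leqNgt => h; apply: contra q0 => on.
move: h; rewrite -(subnK (ltnW on)) exprD dvdp_mul2r ?expf_neq0 ?polyX_eq0 // => h.
have : 'X %| q ^+ 3.
  by apply: dvdp_trans h; rewrite -{1}['X]expr1 dvdp_exp2l // subn_gt0.
by rewrite -{1}['X]subr0 -polyC0 dvdp_XsubCl /root horner_exp expf_eq0.
Qed.

(** The numerical shadow of a counterexample of degree at most $\deg F$. Either $F(1) = 0$ and a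
    factor $(X^3-X)^2$ is removed, which accounts for one unit of $b$, or $F$ is replaced by the
    root $G$ of its cube part, which accounts for one unit of $a$. *)
Lemma odd_traceless_descent m F : odd_traceless m F -> F != 0 -> (size F <= 3 * m + 1)%N ->
  exists l a b, (2 * m + 1 <= 3 ^ a * (2 * l + 1) + 2 * b)%N /\
    (3 ^ a * (3 * l + 1) + 6 * b < size F)%N.
Proof.
have [n] := ubnP (size F); elim: n m F => // n IH m F; rewrite ltnS => hn pF F0 sF.
(* A size is one more than a degree, so the bound in the conclusion says: at most $\deg F$. *)
have s2 : (2 * m + 1 < size F)%N.
  by case: pF => _ _ d; have := dvdp_leq F0 d; rewrite size_polyXn.
have [F1|F1] := eqVneq F.[1] 0.
  have m0 : (0 < m)%N by lia.
  have [G pG hG] := odd_traceless_div_vdm1_sq m0 pF F1.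
  have G0 : G != 0 by apply: contra_neq F0 => e; rewrite hG e mulr0.
  have sG : size F = (size G + 6)%N by rewrite hG size_vdm1_sqM.
  have [||l [a [b [h1 h2]]]] := IH _ _ _ pG G0; try lia.
  by exists l, a, b.+1; split; lia.
have [G [oG tG d3 G0 sG]] := odd_traceless_cube pF F0 sF F1.
have [l pG hl] := odd_traceless_order oG tG G0.
have hl1 := hl _ d3.
have sG2 : (2 * l + 1 < size G)%N.
  by case: pG => _ _ d; have := dvdp_leq G0 d; rewrite size_polyXn.
(* Cubing the counterexample found for $G$ raises $a$ by one and triples $b$; if $\deg G$ is already
   above $3l$, then $P_l$ itself replaces $G$. *)
have [sGl|sGl] := leqP (size G) (3 * l + 1).
  have [||l' [a [b [h1 h2]]]] := IH _ _ _ pG G0; try lia.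
  by exists l', a.+1, (3 * b)%N; split; rewrite expnS; lia.
by exists l, 1%N, 0%N; split; rewrite expn1; lia.
Qed.
End UnivariateF3.

(** * Homogenization *)

Section Homogenize.
Variables (R : comNzRingType) (A : comAlgType R).
Implicit Types (F G : {poly R}) (u v : A).

Definition homogenize d F u v : A := \sum_(i < d.+1) F`_i *: (u ^+ i * v ^+ (d - i)).

Lemma homogenizeD d F G u v :
  homogenize d (F + G) u v = homogenize d F u v + homogenize d G u v.
Proof. by rewrite -big_split /=; apply: eq_bigr => i _; rewrite coefD scalerDl. Qed.

Lemma homogenizeZ d c F u v : homogenize d (c *: F) u v = c *: homogenize d F u v.
Proof. by rewrite scaler_sumr; apply: eq_bigr => i _; rewrite coefZ scalerA. Qed.

Lemma homogenizeC d c u v : homogenize d c%:P u v = c *: v ^+ d.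
Proof.
rewrite /homogenize big_ord_recl coefC /= expr0 mul1r subn0 big1 ?addr0 //.
by move=> i _; rewrite coefC /= scale0r.
Qed.

Lemma homogenize_recr d F u v :
  homogenize d.+1 F u v = v * homogenize d F u v + F`_d.+1 *: u ^+ d.+1.
Proof.
rewrite /homogenize big_ord_recr /= subnn mulr1 mulr_sumr; congr (_ + _).
apply: eq_bigr => i _; rewrite -scalerAr; congr (_ *: _).
have hi : (i <= d)%N by rewrite -ltnS.
by rewrite (subSn hi) [v ^+ _.+1]exprS mulrCA.
Qed.

Lemma homogenizeS d F u v : (size F <= d.+1)%N ->
  homogenize d.+1 F u v = v * homogenize d F u v.
Proof. by move=> s; rewrite homogenize_recr nth_default ?scale0r ?addr0. Qed.

Lemma homogenizeMX d F u v : homogenize d.+1 (F * 'X) u v = u * homogenize d F u v.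
Proof.
rewrite /homogenize big_ord_recl coefMX /= scale0r add0r mulr_sumr.
apply: eq_bigr => i _; rewrite coefMX /= -scalerAr; congr (_ *: _).
by rewrite /bump /= add1n subSS [u ^+ _.+1]exprS mulrA.
Qed.

Lemma homogenizeMXn n d F u v : homogenize (d + n) (F * 'X^n) u v = u ^+ n * homogenize d F u v.
Proof.
elim: n => [|n IH]; first by rewrite addn0 expr0 mulr1 mul1r.
by rewrite addnS exprSr mulrA homogenizeMX IH exprS mulrA.
Qed.

(** Homogenization is compatible with affine substitutions, which become linear in $u$ and $v$. *)
Lemma homogenize_comp d F a c u v : (size F <= d.+1)%N ->
  homogenize d F (a *: u + c *: v) v = homogenize d (F \Po (a *: 'X + c%:P)) u v.
Proof.
have sL : (size (a *: 'X + c%:P : {poly R})%R <= 2)%N.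
  apply: leq_trans (size_polyD _ _) _; rewrite geq_max.
  rewrite (leq_trans (size_scale_leq _ _)) ?size_polyX //.
  by apply: leq_trans (size_polyC_leq1 _) _.
elim/poly_ind: F d => [|F b IH] d sF.
  by rewrite comp_poly0 -[0]polyC0 !homogenizeC.
have [F0|F0] := eqVneq F 0.
  by rewrite F0 mul0r add0r comp_polyC !homogenizeC.
move: sF; rewrite size_MXaddC (negPf F0) /=; case: d => [|d] sF.
  by move: sF; rewrite ltnS leqn0 size_poly_eq0 (negPf F0).
rewrite comp_polyD comp_polyM comp_polyX comp_polyC mulrDr.
rewrite !homogenizeD !homogenizeC homogenizeMX IH //; congr (_ + _).
rewrite -scalerAr homogenizeZ homogenizeMX [_ * c%:P]mulrC mul_polyC homogenizeZ homogenizeS; last first.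
  apply: leq_trans (size_comp_poly_leq _ _) _; rewrite ltnS.
  case: (size F) sF => // s; case: (size _) sL => [|[|[|//]]] _ /=; rewrite ?muln0 ?muln1 //.
by rewrite mulrDl -!scalerAl.
Qed.

End Homogenize.

Lemma homogenize_map (R : comNzRingType) (A B : comAlgType R) (phi : {lrmorphism A -> B})
    d (F : {poly R}) (u v : A) :
  phi (homogenize d F u v) = homogenize d F (phi u) (phi v).
Proof.
rewrite /homogenize linear_sum; apply: eq_bigr => i _ /=.
by rewrite linearZ /= rmorphM !rmorphXn.
Qed.

(** Multiplication by $p$ is injective and shifts the grading, so only one homogeneous component of
    $q$ can be nonzero. *)
Lemma dhomog_cancel (R : idomainType) n c b (p q : {mpoly R[n]}) :
  p != 0 -> p \is c.-homog -> p * q \is (c + b).-homog -> q \is b.-homog.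
Proof.
move=> p0 hp hpq.
have e : p * q = p * pihomog mdeg b q.
  rewrite -[LHS](pihomog_dE hpq) {1}(pihomog_partitionE (leqnn (mmeasure mdeg q))).
  rewrite mulr_sumr raddf_sum /=.
  transitivity (\sum_(d < mmeasure mdeg q | d == b :> nat) p * pihomog mdeg b q).
    rewrite [RHS]big_mkcond; apply: eq_bigr => d _; case: eqP => [->|/eqP db].
      by rewrite pihomog_dE // dhomogM // pihomogP.
    by rewrite (@pihomog_ne0 _ _ _ (c + d)) // ?eqn_add2l // dhomogM // pihomogP.
  case: (ltnP b (mmeasure mdeg q)) => hb.
    by rewrite (big_pred1 (Ordinal hb)) // => d; rewrite -val_eqE.
  rewrite big_pred0 => [|d]; last by apply/negP => /eqP e; move: (ltn_ord d); rewrite e ltnNge hb.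
  suff -> : pihomog mdeg b q = 0 by rewrite mulr0.
  rewrite pihomogE big_seq_cond big1 // => m /andP [hm /eqP e].
  by have := mmeasure_mnm_lt mdeg hm; rewrite e ltnNge hb.
by rewrite (mulfI p0 e) pihomogP.
Qed.

Lemma mpolyF3_three0 : 3%:R = 0 :> MP.
Proof. by rewrite -mpolyC_nat F3_three0 mpolyC0. Qed.

(** The polynomial $e_1$. In characteristic 3 it equals $(x_1-x_3)+(x_2-x_3)$, so it is translation
    invariant and homogenizes the one-variable model. *)
HB.lock Definition sum3 : MP := x0 + x1 + x2.
Lemma sum3E : sum3 = x0 + x1 + x2. Proof. by rewrite sum3.unlock. Qed.

Lemma s12_sum3 : msym s12 sum3 = sum3.
Proof. by rewrite sum3E !msymD !s12_X [X in X + _]addrC. Qed.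
Lemma cyc_sum3 : cyc sum3 = sum3.
Proof. by rewrite sum3E !cycD !cyc_X [LHS]addrC addrA. Qed.
Lemma sum3_dhomog : sum3 \is 1.-homog.
Proof. by rewrite sum3E !rpredD // dhomogX /= mdeg1. Qed.

Lemma cyc_y12_F3 : cyc (y12 k) = y12 k - sum3.
Proof.
rewrite cyc_y12 sum3E /y12.
have -> : x0 - x1 - (x0 + x1 + x2) = x1 - x2 - 3%:R * x1 by ring.
by rewrite mpolyF3_three0 mul0r subr0.
Qed.

(** The translation-invariant polynomial of degree $d$ that restricts to $F$ on the plane $e_1 = 1$.
    *)
HB.lock Definition homog_lift d (F : {poly k}) : MP := homogenize d F (y12 k) sum3.
Lemma homog_liftE d F : homog_lift d F = homogenize d F (y12 k) sum3.
Proof. by rewrite homog_lift.unlock. Qed.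

Lemma s12_homog_lift d (F : {poly k}) : (size F <= d.+1)%N -> msym s12 (homog_lift d F) = homog_lift d (flip F).
Proof.
move=> sF; rewrite !homog_liftE (homogenize_map (msym s12)) /= s12_y12 s12_sum3.
have -> : - y12 k = (-1) *: y12 k + 0 *: sum3 by rewrite scaleN1r scale0r addr0.
move: (y12 k) sum3 => u v; rewrite (@homogenize_comp _ _ d F (-1) 0 u v sF).
by congr homogenize; rewrite flipE scaleN1r polyC0 addr0.
Qed.

Lemma cyc_homog_lift d (F : {poly k}) : (size F <= d.+1)%N -> cyc (homog_lift d F) = homog_lift d (shift F).
Proof.
move=> sF; rewrite !homog_liftE cycE (homogenize_map (msym c3)) /= -!cycE cyc_y12_F3 cyc_sum3.
have -> : y12 k - sum3 = 1 *: y12 k + (-1) *: sum3 by rewrite scaleN1r scale1r.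
move: (y12 k) sum3 => u v; rewrite (@homogenize_comp _ _ d F 1 (-1) u v sF).
by congr homogenize; rewrite shiftE scale1r polyCN polyC1.
Qed.

Lemma homog_lift_dhomog d (F : {poly k}) : homog_lift d F \is d.-homog.
Proof.
rewrite homog_liftE; apply: rpred_sum => -[i hi] _ /=; apply: rpredZ.
have := dhomogM (dhomogMn i (y12_dhomog k)) (dhomogMn (d - i) sum3_dhomog).
by rewrite !mul1n subnKC.
Qed.

(** * A basis of the twisted polynomials over $\mathbf{F}_3$ *)

(** The points $(X, 0, 1-X)$ form a section on which $e_1 = 1$ and $x_1-x_2 = X$. *)
Definition dehom_pt (i : 'I_3) : {poly k} :=
  if i == 0 then 'X else if i == 1 then 0 else 1 - 'X.
Definition dehom (p : MP) : {poly k} := mmap (@polyC k) dehom_pt p.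

HB.instance Definition _ := GRing.RMorphism.copy dehom (mmap (@polyC k) dehom_pt).

Lemma dehomZ c p : dehom (c *: p) = c *: dehom p.
Proof. by rewrite /dehom mmapZ mul_polyC. Qed.

Lemma dehomB : {morph dehom : p q / p - q}. Proof. exact: rmorphB. Qed.
Lemma dehomM : {morph dehom : p q / p * q}. Proof. exact: rmorphM. Qed.

Lemma dehomX i : dehom 'X_i = dehom_pt i.
Proof. by rewrite /dehom mmapX mmap1U. Qed.

Lemma dehom_y12 : dehom (y12 k) = 'X.
Proof. by rewrite /y12 rmorphB /= !dehomX /dehom_pt /= subr0. Qed.
Lemma dehom_sum3 : dehom sum3 = 1.
Proof. by rewrite sum3E !rmorphD /= !dehomX /dehom_pt /= addr0 addrC subrK. Qed.

Lemma dehom_homog_lift d (F : {poly k}) : (size F <= d.+1)%N -> dehom (homog_lift d F) = F.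
Proof.
move=> sF; rewrite homog_liftE /homogenize rmorph_sum /=.
rewrite -[RHS]coefK poly_def.
rewrite (big_ord_widen_cond d.+1 xpredT (fun i => F`_i *: 'X^i) sF) [RHS]big_mkcond.
apply: eq_bigr => -[i hi] _ /=; rewrite dehomZ rmorphM !rmorphXn /= dehom_y12 dehom_sum3.
by rewrite expr1n mulr1; case: ltnP => // h; rewrite nth_default ?scale0r.
Qed.

Lemma homog_lift_wronsk d1 d2 (F G : {poly k}) : (size F <= d1.+1)%N -> (size G <= d2.+1)%N ->
  shift_wronsk F G != 0 -> wronsk (homog_lift d1 F) (homog_lift d2 G) != 0.
Proof.
move=> sF sG; apply: contra_neq => w0.
have <- : dehom (wronsk (homog_lift d1 F) (homog_lift d2 G)) = shift_wronsk F G.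
  have sF' : (size (shift F) <= d1.+1)%N by rewrite size_shift.
  have sG' : (size (shift G) <= d2.+1)%N by rewrite size_shift.
  rewrite /wronsk /shift_wronsk.
  rewrite (cyc_homog_lift sF) (cyc_homog_lift sG).
  rewrite dehomB !dehomM.
  by rewrite (dehom_homog_lift sF) (dehom_homog_lift sG) (dehom_homog_lift sF') (dehom_homog_lift sG').
by rewrite w0 rmorph0.
Qed.

Lemma homog_liftD d (F G : {poly k}) : homog_lift d (F + G) = homog_lift d F + homog_lift d G.
Proof. by rewrite !homog_liftE homogenizeD. Qed.

Lemma homog_lift_neg d (F : {poly k}) : homog_lift d (- F) = - homog_lift d F.
Proof. by rewrite -scaleN1r !homog_liftE homogenizeZ scaleN1r. Qed.

Lemma homog_lift_zero d : homog_lift d 0 = 0.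
Proof. by rewrite !homog_liftE -[0]polyC0 homogenizeC scale0r. Qed.

Lemma homog_lift_trace d (F : {poly k}) : (size F <= d.+1)%N -> F + shift F + shift (shift F) = 0 ->
  homog_lift d F + cyc (homog_lift d F) + cyc (cyc (homog_lift d F)) = 0.
Proof.
by move=> sF tF; rewrite !cyc_homog_lift ?size_shift // -!homog_liftD tF homog_lift_zero.
Qed.

Lemma homog_lift_twisted m d (F : {poly k}) : F != 0 -> (size F <= d.+1)%N -> odd_traceless m F ->
  twisted (2 * m + 1) (homog_lift d F).
Proof.
move=> F0 sF [oF tF /dvdpP [q hq]]; split.
- by rewrite s12_homog_lift // oF homog_lift_neg.
- exact: homog_lift_trace.
have n_d : (2 * m + 1 <= d)%N.
  have q0 : q != 0 by apply: contra_neq F0 => e; rewrite hq e mul0r.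
  move: sF; rewrite hq size_Mmonic ?monicXn // size_polyXn addnS /=.
  by move: q0; rewrite -size_poly_gt0; case: (size q) => // s _; rewrite addSn ltnS; apply: leq_trans; rewrite leq_addl.
by exists (homog_lift (d - (2 * m + 1)) q); rewrite !homog_liftE hq -{1}(subnK n_d) homogenizeMXn mulrC.
Qed.

Lemma homog_lift_lead d (F : {poly k}) : exists r, homog_lift d F = F`_d *: y12 k ^+ d + sum3 * r.
Proof.
case: d => [|d]; last by exists (homog_lift d F); rewrite !homog_liftE homogenize_recr addrC.
by exists 0; rewrite homog_liftE /homogenize big_ord1 !expr0 mulr0 addr0 mulr1.
Qed.

(** The polynomial $e_2$. *)
HB.lock Definition sym2 : MP := x0 * x1 + x1 * x2 + x0 * x2.
Lemma sym2E : sym2 = x0 * x1 + x1 * x2 + x0 * x2. Proof. by rewrite sym2.unlock. Qed.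

Lemma sym2_sym : sym2 \is symmetric.
Proof.
apply/symmetricP; rewrite sym2E !msymD !msymM !s12_X !cycD !cycM !cyc_X.
by split; ring.
Qed.

Lemma sym2_dhomog : sym2 \is 2.-homog.
Proof.
have h i : ('X_i : MP) \is 1.-homog by rewrite dhomogX /= mdeg1.
by rewrite sym2E; do 2 (apply: rpredD; last exact: dhomogM (h _) (h _)); exact: dhomogM (h _) (h _).
Qed.

Lemma y12_sq : y12 k ^+ 2 = - sym2 + sum3 * (x0 + x1).
Proof.
rewrite sym2E sum3E /y12.
have -> : - (x0 * x1 + x1 * x2 + x0 * x2) + (x0 + x1 + x2) * (x0 + x1) = (x0 - x1) ^+ 2 + 3%:R * (x0 * x1).
  by ring.
by rewrite mpolyF3_three0 mul0r addr0.
Qed.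

Lemma y12_pow_sym2 t : exists r, y12 k ^+ (2 * t) = (- sym2) ^+ t + sum3 * r.
Proof.
rewrite exprM y12_sq; elim: t => [|t [r hr]]; first by exists 0; rewrite !expr0 mulr0 addr0.
exists ((x0 + x1) * (- sym2) ^+ t + (- sym2) * r + sum3 * (x0 + x1) * r).
rewrite exprS hr [in RHS]exprS; move: (x0 + x1) ((- sym2) ^+ t) (- sym2) sum3 => a b c d; ring.
Qed.

Lemma sum3_neq0 : sum3 != 0.
Proof.
apply/eqP => h; have := dehom_sum3; rewrite h rmorph0 => /esym /eqP; by rewrite oner_eq0.
Qed.

Lemma odd_traceless_odd_degree m d (F : {poly k}) : odd_traceless m F -> size F = d.+1 -> odd d.
Proof.
case=> oF _ _ sF; apply: contraT => ev.
have F0 : F != 0 by rewrite -size_poly_eq0 sF.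
have := congr1 (fun p : {poly k} => lead_coef p) oF.
rewrite flipE lead_coef_comp ?size_polyN ?size_polyX // lead_coefN lead_coefX sF /=.
rewrite -signr_odd (negPf ev) expr0 mulr1 lead_coefN => /eqP.
by rewrite -addr_eq0 -mulr2n -mulr_natr mulf_eq0 orbF lead_coef_eq0 (negPf F0).
Qed.

(** Modulo $e_1$ only the leading term of a homogenization survives. As both degrees are odd, the
    ratio of the leading terms is a power of $(x_1-x_2)^2 \equiv -e_2$, which is symmetric; so some
    symmetric multiple of the first polynomial cancels the second one modulo $e_1$. *)
Lemma reduce_mod_sum3 m d1 d2 (F G : {poly k}) : odd_traceless m F -> odd_traceless m G ->
  size F = d1.+1 -> size G = d2.+1 -> (d1 <= d2)%N ->
  exists r q q', [/\ r \is symmetric, homog_lift d2 G - r * homog_lift d1 F = sum3 * q,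
     q = q' * y12 k ^+ (2 * m + 1) & r \is (d2 - d1).-homog].
Proof.
move=> pF pG sF sG d12.
have oF := odd_traceless_odd_degree pF sF; have oG := odd_traceless_odd_degree pG sG.
have F0 : F != 0 by rewrite -size_poly_eq0 sF.
have G0 : G != 0 by rewrite -size_poly_eq0 sG.
have low (H : {poly k}) d : odd_traceless m H -> H != 0 -> size H = d.+1 -> exists q : {poly k},
    [/\ H = q * 'X^(2 * m + 1), (2 * m + 1 <= d)%N & q`_(d - (2 * m + 1)) = lead_coef H].
  case=> _ _ /dvdpP [q hq] H0 sH; exists q.
  have q0 : q != 0 by apply: contra_neq H0 => e; rewrite hq e mul0r.
  have sq : (size q + (2 * m + 1) = d.+1)%N.
    by rewrite -sH hq size_Mmonic ?monicXn // size_polyXn !addnS.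
  have hd : (2 * m + 1 <= d)%N.
    by move: q0 sq; rewrite -size_poly_gt0; case: (size q) => // s _; clear; lia.
  split=> //; rewrite hq lead_coefM lead_coefXn mulr1 lead_coefE; congr (q`_ _).
  by move: sq hd; case: (size q) => [|s]; lia.
have [qF [hF nF lF]] := low _ _ pF F0 sF; have [qG [hG nG lG]] := low _ _ pG G0 sG.
set n := (2 * m + 1)%N in hF hG nF nG lF lG *.
have [rF hrF] := homog_lift_lead (d1 - n) qF; have [rG hrG] := homog_lift_lead (d2 - n) qG.
rewrite lF in hrF; rewrite lG in hrG.
have [t ht] : exists t, (d2 - d1 = 2 * t)%N.
  by exists (d2 - d1)./2; rewrite mul2n halfK oddB // oF oG subn0.
have [u hu] := y12_pow_sym2 t.
pose a := lead_coef F; pose b := lead_coef G.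
have a0 : a != 0 by rewrite lead_coef_eq0.
(* Modulo $e_1$ the two homogenizations are $a y^{d_1}$ and $b y^{d_2}$ with $y^2 = -e_2$. *)
pose r : MP := (b / a) *: (- sym2) ^+ t.
have sr : r \is symmetric by rewrite rpredZ // rpredX // rpredN sym2_sym.
have dr : r \is (d2 - d1).-homog.
  by rewrite ht rpredZ // dhomogMn // rpredN sym2_dhomog.
have [q' hq'] : exists q', homog_lift (d2 - n) qG - r * homog_lift (d1 - n) qF = sum3 * q'.
  exists (rG + (b / a) *: u * (a *: y12 k ^+ (d1 - n)) - r * rF).
  rewrite hrF hrG.
  have -> : (d2 - n = 2 * t + (d1 - n))%N by lia.
  have -> : lead_coef G *: y12 k ^+ (2 * t + (d1 - n)) = (b / a) *: ((- sym2) ^+ t + sum3 * u) * (a *: y12 k ^+ (d1 - n)).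
    by rewrite exprD hu -scalerAl -scalerAr scalerA divfK // scalerAl.
  rewrite scalerDr scalerAr -/r -/a.
  move: (a *: _) ((b / a) *: u) => Y U; clearbody r; clear.
  move: sum3 => s; ring.
exists r, (q' * y12 k ^+ n), q'; split => //.
rewrite !homog_liftE hF hG -{1}(subnK nG) -{1}(subnK nF) !homogenizeMXn -!homog_liftE.
rewrite mulrCA -mulrBr hq'; ring.
Qed.

Lemma twisted_cancel_sum3 m f q' : sum3 * (q' * y12 k ^+ (2 * m + 1)) = f ->
  msym s12 f = - f -> f + cyc f + cyc (cyc f) = 0 ->
  twisted (2 * m + 1) (q' * y12 k ^+ (2 * m + 1)).
Proof.
set q := q' * _ => <- sf tf; split; last by exists q'.
  by apply: (mulfI sum3_neq0); move: sf; rewrite msymM s12_sum3 mulrN.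
apply: (mulfI sum3_neq0); move: tf.
by rewrite cycM cyc_sum3 cycM cyc_sum3 mulr0 -!mulrDr.
Qed.

(** The basis of the one-variable model has total degree at most $6m+4$; dividing the combination by
    $e_1$ brings this down to $6m+3$, which the wronskian bound then makes exact. *)
Lemma twisted_basis m : exists (F : {poly k}) d1 d2 (f q : MP),
  [/\ [/\ odd_traceless m F, F != 0 & size F = d1.+1], [/\ twisted (2 * m + 1) f, twisted (2 * m + 1) q,
    f \is d1.-homog & q \is d2.-homog], wronsk f q != 0, (d1 + d2 = 3 * (2 * m + 1))%N
   & (d1 <= d2.+1)%N].
Proof.
have [F [G [pF pG w sFG s]]] := odd_traceless_basis m.
have F0 : F != 0 by apply: contra_neq w => ->; rewrite /shift_wronsk shift0 !(mul0r, mulr0) subrr.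
have G0 : G != 0 by apply: contra_neq w => ->; rewrite /shift_wronsk shift0 !(mul0r, mulr0) subrr.
have [d1 sF] : exists d, size F = d.+1 by exists (size F).-1; rewrite prednK // lt0n size_poly_eq0.
have [d2 sG] : exists d, size G = d.+1 by exists (size G).-1; rewrite prednK // lt0n size_poly_eq0.
have d12 : (d1 <= d2)%N by move: sFG; rewrite sF sG.
have [r [q [q' [sr hq qq' dr]]]] := reduce_mod_sum3 pF pG sF sG d12.
have oG := odd_traceless_odd_degree pG sG.
case: d2 sG d12 oG hq dr => // d2 sG d12 oG hq dr.
have tf : twisted (2 * m + 1) (homog_lift d1 F) by apply: homog_lift_twisted => //; rewrite sF.
have tg : twisted (2 * m + 1) (homog_lift d2.+1 G) by apply: homog_lift_twisted => //; rewrite sG.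
have [r1 r2] := (symmetricP r).1 sr.
have w0 := @homog_lift_wronsk d1 d2.+1 F G (eq_leq sF) (eq_leq sG) w.
have hf := homog_lift_dhomog d1 F; have hg := homog_lift_dhomog d2.+1 G.
move: (homog_lift d1 F) (homog_lift d2.+1 G) hq tf tg w0 hf hg => f g hq tf tg w0 hf hg.
have [sf trf _] := tf; have [sg trg _] := tg.
have tq : twisted (2 * m + 1) q.
  rewrite qq'; apply: (@twisted_cancel_sum3 m (g - r * f)).
  - by rewrite hq qq'.
  - by rewrite msymB msymM sf sg r1 mulrN opprB opprK addrC.
  - rewrite !cycB !cycM !r2 (twisted_cyc2 tf) (twisted_cyc2 tg).
    by move: (cyc f) (cyc g) => a b; ring.
have hq1 : q \is d2.-homog.
  apply: (@dhomog_cancel _ _ 1 d2 sum3 q sum3_neq0 sum3_dhomog).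
  rewrite -hq add1n rpredB //; have := dhomogM dr hf; by rewrite subnK.
have w1 : wronsk f q != 0.
  apply: contra_neq w0 => e; have : sum3 * wronsk f q = wronsk f g.
    have -> : sum3 * wronsk f q = f * cyc (sum3 * q) - (sum3 * q) * cyc f.
      by rewrite /wronsk cycM cyc_sum3; move: (cyc f) (cyc q) sum3 => a b c; ring.
    rewrite -hq cycB cycM r2 /wronsk; move: (cyc f) (cyc g) => a b; ring.
  by rewrite e mulr0 => <-.
have on : odd (2 * m + 1) by rewrite oddD oddM.
have := wronsk_degree on tf tq hf hq1 w1 => dge.
exists F, d1, d2, f, q; split=> //.
by move: s dge; rewrite sF sG; clear; lia.
Qed.

(** * The sum of the subrepresentations sign, triv and sign-triv *)

Local Notation S3 := [set: 'S_3]%G.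

Lemma two_neq0 : 2%:R != 0 :> k. Proof. by []. Qed.

Lemma odd_s12 : odd_perm s12 = true. Proof. by rewrite odd_tperm. Qed.
Lemma odd_c3 : odd_perm c3 = false.
Proof.
have [h _] := tperm3E; have := odd_tperm i0 i2.
by rewrite h odd_permM odd_s12 /=; case: (odd_perm c3).
Qed.

Section FromModule.
Variables (n : nat) (rG : mx_representation k S3 n).

(** A pointwise fixed subspace modulo which the group acts by the sign is a feature common to all
    three types: it is zero for sign and everything for triv. *)
Lemma sign_triv_split : is_sign_triv rG -> exists U : 'M[k]_n,
  [/\ forall u : 'rV_n, (u <= U)%MS -> forall s, u *m rG s = u
    & forall (u : 'rV_n) (s : 'S_3), (u *m rG s - (-1) ^+ s *: u <= U)%MS].
Proof.
case=> _ _ [U [Um [[_ ht] [_ hs]]]]; exists U; split=> [u uU s|u s].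
  have Gs : s \in S3 by rewrite inE.
  rewrite -(in_submodK uU) -(val_submodJ Um) //.
  by have /= -> := ht s; rewrite mulmx1.
have Gs : s \in S3 by rewrite inE.
rewrite -in_factmod_eq0 linearB /= (in_factmodJ Um) //.
have /= -> := hs s; rewrite mul_mx_scalar linearZ /= subrr //.
Qed.
End FromModule.

Lemma unipotent_trace (w r u : MP) : w - r + (w + u - r) + (w + u + u - r) = 0.
Proof.
transitivity (3%:R * (w - r + u)); first by ring.
by rewrite mpolyF3_three0 mul0r.
Qed.

(** Let $w$ be in such a subrepresentation and subtract from it the symmetric polynomial $(w +
    s_{12}w)/2$. The result is anti-invariant, and its trace under the unipotent 3-cycle vanishes
    because $(c-1)^2 = 0$ on $w$ and $3 = 0$. *)
Lemma piece_decomp m (W : MP -> Prop) w : sign_triv_subrep m W -> W w ->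
  exists f r, [/\ twisted (2 * m + 1) f, r \is symmetric & w = f + r].
Proof.
case=> qW [n [rG [hr [phi [inj eqv im]]]]] Ww.
have [U [hU hV]] : exists U : 'M[k]_n,
  [/\ forall u : 'rV_n, (u <= U)%MS -> forall s, u *m rG s = u
    & forall (u : 'rV_n) (s : 'S_3), (u *m rG s - (-1) ^+ s *: u <= U)%MS].
  case: hr => [[_ h]|[_ h]|]; last exact: sign_triv_split.
    exists 0; split=> [u|u s]; first by rewrite submx0 => /eqP -> s; rewrite mul0mx.
    by rewrite h mul_mx_scalar subrr sub0mx.
  by exists 1%:M; split=> [u _ s|u s]; [rewrite h mulmx1|rewrite submx1].
have [v hv] := (im w).1 Ww.
(* $w + s_{12}w$ is invariant; divided by $2$, it is the symmetric part of $w$. *)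
pose u0 := v *m rG s12 - (-1) ^+ s12 *: v.
have u0E : v *m rG s12 = u0 - v by rewrite /u0 odd_s12 expr1 scaleN1r opprK addrK.
have inv0 s : u0 *m rG s = u0 by apply: hU; apply: hV.
pose r := 2%:R^-1 *: phi u0.
have sr : r \is symmetric.
  by apply/issymP => s; rewrite msymZ -eqv inv0.
have [r1 r2] := (symmetricP r).1 sr.
have two x : 2%:R^-1 *: x + 2%:R^-1 *: x = x :> MP.
  by rewrite -scalerDr -mulr2n -scaler_nat scalerA mulVf ?scale1r // two_neq0.
pose f := w - r.
have sw : msym s12 w = phi u0 - w by rewrite hv -eqv u0E linearB.
have sf : msym s12 f = - f.
  by rewrite msymB sw r1 /f opprB -{1}(two (phi u0)) -/r addrAC addrK.
have qf : quasi_invariant m f.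
  by apply: quasiD; [exact: qW|apply/quasiN/quasi_sym].
exists f, r; split=> //; last by rewrite /f subrK.
split=> //; last exact: (anti_quasi_dvd two_neq0 qf sf).
pose u1 := v *m rG c3 - (-1) ^+ c3 *: v.
have u1E : v *m rG c3 = v + u1 by rewrite /u1 odd_c3 expr0 scale1r addrC subrK.
have cw : cyc w = w + phi u1 by rewrite cycE hv -eqv u1E linearD.
have ce : cyc (phi u1) = phi u1 by rewrite cycE -eqv hU //; apply: hV.
rewrite /f !cycB !r2 cw cycD cw ce.
exact: unipotent_trace.
Qed.

Lemma twisted0 n : twisted n (0 : MP).
Proof. by split; [rewrite msym0 oppr0|rewrite !cyc0 !addr0|exists 0; rewrite mul0r]. Qed.

Lemma twistedD n (f g : MP) : twisted n f -> twisted n g -> twisted n (f + g).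
Proof.
move=> tf tg; have [sf _ [q hq]] := tf; have [sg _ [q' hq']] := tg; split.
- by rewrite msymD sf sg opprD.
- rewrite !cycD (twisted_cyc2 tf) (twisted_cyc2 tg); move: (cyc f) (cyc g) => a b; ring.
- by exists (q + q'); rewrite hq hq' mulrDl.
Qed.

Lemma Q_decomp m p : Q_sign_triv m p ->
  exists f r, [/\ twisted (2 * m + 1) f, r \is symmetric & p = f + r].
Proof.
case=> s [-> hs]; elim: s hs => [|w s IH] hs.
  by exists 0, 0; split; [exact: twisted0|exact: rpred0|rewrite big_nil addr0].
have [|f [r [tf sr e]]] := IH; first by move=> w' hw'; apply: hs; rewrite inE hw' orbT.
have [W [hW Ww]] := hs w (mem_head _ _).
have [f' [r' [tf' sr' ->]]] := piece_decomp hW Ww.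
exists (f' + f), (r' + r); split; [exact: twistedD|exact: rpredD|].
by rewrite big_cons e addrACA.
Qed.

Lemma trivial_repr_proof : mx_repr S3 (fun _ : 'S_3 => 1%:M : 'M[k]_1).
Proof. by split=> // s t _ _; rewrite mulmx1. Qed.
Definition triv1 := MxRepresentation trivial_repr_proof.

Lemma sign_repr_proof : mx_repr S3 (fun s : 'S_3 => ((-1) ^+ s)%:M : 'M[k]_1).
Proof.
split=> [|s t _ _]; first by rewrite odd_perm1.
by rewrite -scalar_mxM odd_permM signr_addb.
Qed.
Definition sign1 := MxRepresentation sign_repr_proof.

Section Line.
Variables (f : MP) (f0 : f != 0).
Definition line_map (v : 'rV[k]_1) : MP := v 0 0 *: f.
Lemma line_map_linear : linear line_map.
Proof. by move=> a u v; rewrite /line_map !mxE scalerDl scalerA. Qed.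
HB.instance Definition _ := GRing.isLinear.Build k 'rV[k]_1 MP *:%R line_map line_map_linear.

Lemma line_map_inj : injective line_map.
Proof.
move=> u v /eqP; rewrite /line_map -subr_eq0 -scalerBl scaler_eq0 (negPf f0) orbF subr_eq0 => /eqP e.
by apply/rowP => i; rewrite !ord1.
Qed.
End Line.

Lemma line_piece m (chi : 'S_3 -> k) (rG : mx_representation k S3 1) (f : MP) :
  f != 0 -> (is_sign rG \/ is_triv rG) -> (forall s, rG s = (chi s)%:M) ->
  (forall s, msym s f = chi s *: f) -> quasi_invariant m f ->
  exists W, sign_triv_subrep m W /\ W f.
Proof.
move=> f0 hr hchi hf qf; exists (fun p => exists v, p = line_map f v); split; last first.
  by exists 1%:M; rewrite /line_map mxE scale1r.
split; first by move=> p [v ->]; apply: quasiZ.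
exists 1%N, rG; split; first by case: hr; [constructor 1|constructor 2].
exists (line_map f : {linear _ -> _}); split=> //=; first exact: line_map_inj.
by move=> s v; rewrite hchi mul_mx_scalar /line_map mxE msymZ hf scalerA mulrC.
Qed.

Lemma sym_piece m (r : MP) : r \is symmetric -> exists W, sign_triv_subrep m W /\ W r.
Proof.
move=> sr; have [r0|r0] := eqVneq r 0; last first.
  apply: (@line_piece m (fun=> 1) triv1) => //; first by right.
    by move=> s; rewrite scale1r; apply/issymP.
  exact: quasi_sym.
have [|||||W [hW _]] := @line_piece m (fun=> 1) triv1 1; rewrite ?oner_eq0 //; first by right.
- by move=> s; rewrite scale1r msym1.
- exact/quasi_sym/rpred1.
case: (hW) => _ [n [rG [_ [phi [_ _ im]]]]]; exists W; split=> //.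
by apply/im; exists 0; rewrite linear0.
Qed.

Section Plane.
Variables (n : nat) (f : MP).
Hypotheses (tf : twisted n f).
Let e := cyc f - f.
Hypothesis e0 : e != 0.

(** For twisted $f$ the difference $cf - f$ is invariant: this is where $3 = 0$ makes the
    two-dimensional representation reducible. *)
Lemma plane_inv : e \is symmetric.
Proof.
apply/symmetricP; have [sf _ _] := tf; rewrite /e; split.
  rewrite msymB (twisted_s12_cyc tf) sf opprK.
  have -> : f + cyc f + f = cyc f - f + 3%:R * f by move: (cyc f) => a; ring.
  by rewrite mpolyF3_three0 mul0r addr0.
rewrite cycB (twisted_cyc2 tf).
have -> : - f - cyc f - cyc f = cyc f - f - 3%:R * cyc f by move: (cyc f) => a; ring.
by rewrite mpolyF3_three0 mul0r subr0.
Qed.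

Lemma plane_action s : exists l : k, msym s f = (-1) ^+ s *: f + l *: e.
Proof.
have [sf _ _] := tf; have /issymP se := plane_inv.
elim/S3_ind: s.
- by exists 0; rewrite sf odd_s12 expr1 scaleN1r scale0r addr0.
- by exists 1; rewrite -cycE odd_c3 expr0 !scale1r /e addrC subrK.
- by exists 0; rewrite msym1m odd_perm1 expr0 scale1r scale0r addr0.
move=> s t [l hl] [l' hl']; exists ((-1) ^+ s * l' + l).
rewrite msymMm hl msymD !msymZ se hl' [_ *: (_ *: f + _)]scalerDr !scalerA scalerDl addrA.
by rewrite odd_permM signr_addb.
Qed.

Definition plane_map (v : 'rV[k]_2) : MP := v 0 0 *: e + v 0 1 *: f.
Lemma plane_map_linear : linear plane_map.
Proof.
move=> a u v; rewrite /plane_map !mxE !scalerDl [a *: (_ *: e + _)]scalerDr !scalerA.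
exact: addrACA.
Qed.
HB.instance Definition _ := GRing.isLinear.Build k 'rV[k]_2 MP *:%R plane_map plane_map_linear.

Lemma plane_map_inj : injective plane_map.
Proof.
suff h v : plane_map v = 0 -> v = 0.
  move=> u v /eqP; rewrite -subr_eq0 -linearB => /eqP /h /eqP.
  by rewrite subr_eq0 => /eqP.
have [sf _ _] := tf; have /issymP se := plane_inv.
have f0 : f != 0 by apply: contra_neq e0 => f0; rewrite /e f0 cyc0 subrr.
rewrite /plane_map => h.
have h2 : v 0 0 *: e = v 0 1 *: f.
  have := congr1 (msym s12) h; rewrite msymD !msymZ se sf msym0 scalerN => /eqP.
  by rewrite subr_eq0 => /eqP.
have v1 : v 0 1 = 0.
  move: h; rewrite h2 -mulr2n -scaler_nat => /eqP.
  by rewrite scaler_eq0 (negPf two_neq0) /= scaler_eq0 (negPf f0) orbF => /eqP.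
have v0 : v 0 0 = 0.
  by move: h2; rewrite v1 scale0r => /eqP; rewrite scaler_eq0 (negPf e0) orbF => /eqP.
apply/rowP => i; rewrite mxE; case: i => [[|[|i]] hi] //.
  by rewrite -v0; congr (v 0 _); apply/val_inj.
by rewrite -v1; congr (v 0 _); apply/val_inj.
Qed.

Variable lam : 'S_3 -> k.
Hypothesis lamP : forall s : 'S_3, msym s f = (-1) ^+ s *: f + lam s *: e.

(** The action in the basis $e = cf-f$, $f$; the coordinates of $sf$ along $e$ are supplied by the
    function lam. *)
Definition plane_mx (s : 'S_3) : 'M[k]_2 :=
  \matrix_(i, j) (if i == 0 then (j == 0)%:R else if j == 0 then lam s else (-1) ^+ s).

Lemma plane_mxE (v : 'rV[k]_2) s :
  ((v *m plane_mx s) 0 0 = v 0 0 + v 0 1 * lam s) *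
  ((v *m plane_mx s) 0 1 = v 0 1 * (-1) ^+ s).
Proof.
split; rewrite mxE !big_ord_recl big_ord0 !mxE /= addr0.
  by rewrite mulr1; congr (_ + v 0 _ * _); apply/val_inj.
by rewrite mulr0 add0r; congr (v 0 _ * _); apply/val_inj.
Qed.

Lemma plane_equivariant (s : 'S_3) v : plane_map (v *m plane_mx s) = msym s (plane_map v).
Proof.
have /issymP se := plane_inv.
rewrite /plane_map !plane_mxE msymD !msymZ se lamP scalerDl [v 0 1 *: (_ *: f + _)]scalerDr !scalerA.
by rewrite -addrA; congr (_ + _); rewrite addrC.
Qed.

(** Injectivity and equivariance of the embedding into the polynomial ring transport the group law,
    so no matrix identity has to be verified. *)
Lemma plane_repr_proof : mx_repr S3 plane_mx.
Proof.
have ext (A B : 'M[k]_2) : (forall v, plane_map (v *m A) = plane_map (v *m B)) -> A = B.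
  by move=> h; apply/row_matrixP => i; rewrite !rowE; apply: plane_map_inj.
split=> [|s t _ _]; apply: ext => v; first by rewrite plane_equivariant msym1m mulmx1.
by rewrite mulmxA !plane_equivariant msymMm.
Qed.
Definition plane := MxRepresentation plane_repr_proof.

Lemma lam_c3 : lam c3 = 1.
Proof.
have := lamP c3; rewrite -cycE odd_c3 expr0 scale1r => h.
have : (lam c3 - 1) *: e = 0.
  by rewrite scalerBl scale1r; apply/eqP; rewrite subr_eq0 {2}/e h addrAC subrr add0r.
by move=> /eqP; rewrite scaler_eq0 (negPf e0) orbF subr_eq0 => /eqP.
Qed.

Let E0 : 'rV[k]_2 := delta_mx 0 0.

Lemma E0P (u : 'rV[k]_2) : u 0 1 = 0 -> u = u 0 0 *: E0.
Proof.
move=> u1; apply/rowP => i; rewrite !mxE eqxx /=.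
case: i => [[|[|i]] hi] //=.
  by rewrite mulr1; congr (u 0 _); apply/val_inj.
by rewrite mulr0 -u1; congr (u 0 _); apply/val_inj.
Qed.

(** The invariant line lies in every nonzero submodule, which makes the plane indecomposable. *)
Lemma plane_socle (U : 'M[k]_2) : mxmodule plane U -> U != 0 -> (E0 <= U)%MS.
Proof.
move=> Um U0; have Gc : c3 \in S3 by rewrite inE.
have /existsP [i ui] : [exists i, row i U != 0].
  apply: contraNT U0; rewrite negb_exists => /forallP h; apply/eqP/row_matrixP => i.
  by rewrite row0; apply/eqP; have := h i; rewrite negbK.
set u := row i U in ui; have uU : (u <= U)%MS by rewrite row_sub.
have scale (a : k) (w : 'rV[k]_2) : w = a *: E0 -> a != 0 -> (w <= U)%MS -> (E0 <= U)%MS.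
  by move=> -> a0 h; rewrite -[E0]scale1r -(mulVf a0) -scalerA scalemx_sub.
have subE i' (A B : 'rV[k]_2) : (A - B) 0 i' = A 0 i' - B 0 i' by rewrite !mxE.
have [u1|u1] := eqVneq (u 0 1) 0.
  apply: (scale (u 0 0) u) => //; first exact: E0P.
  by apply: contra_neq ui => u00; rewrite (E0P u1) u00 scale0r.
(* $c - 1$ maps the plane onto its invariant line. *)
apply: (scale (u 0 1) (u *m plane c3 - u)) => //.
  have -> : u 0 1 = (u *m plane c3 - u) 0 0.
    by rewrite subE plane_mxE lam_c3 mulr1 addrC addKr.
  apply: E0P.
  by rewrite subE plane_mxE odd_c3 mulr1 subrr.
by rewrite addmx_sub ?(eqmx_opp u) // (mxmodule_trans Um).
Qed.

Lemma plane_sign_triv : is_sign_triv plane.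
Proof.
pose U : 'M[k]_2 := delta_mx 0 0.
have Ufix s : U *m plane s = U.
  apply/row_matrixP => i; rewrite row_mul; apply/rowP => j.
  rewrite /U !mxE !big_ord_recl big_ord0 !mxE /=.
  by case: i => [[|[|i]] hi] //=; case: j => [[|[|j]] hj] //=; rewrite ?(mul0r, mul1r, addr0).
have Um : mxmodule plane U by apply/mxmoduleP => s _; rewrite Ufix.
split=> //; last first.
  exists U, Um; split; split.
  - by rewrite mxrank_delta.
  - move=> s; rewrite /= /submod_mx.
    have fixed (m' : nat) (w : 'M[k]_(m', 2)) : (w <= U)%MS -> w *m plane s = w.
      by move=> /submxP [D ->]; rewrite -mulmxA Ufix.
    by rewrite fixed ?val_submodP // val_submodK.
  - by rewrite mxrank_coker mxrank_delta.
  - move=> s; rewrite /= /factmod_mx; set w := val_factmod _.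
    have hw : (w *m plane s - (-1) ^+ s *: w <= U)%MS.
      rewrite -mul_mx_scalar -mulmxBr.
      have -> : plane s - ((-1) ^+ s)%:M = (plane s - ((-1) ^+ s)%:M) *m U.
        apply/matrixP => i j; rewrite [RHS]mxE !big_ord_recl big_ord0 !mxE /=.
        case: i => [[|[|i]] hi] //=; case: j => [[|[|j]] hj] //=;
        by rewrite ?(mulr0, mulr1, addr0, subr0, subrr).
      by rewrite mulmxA submxMl.
    apply/eqP; rewrite -subr_eq0; move: hw; rewrite -in_factmod_eq0 linearB linearZ /=.
    by rewrite /w val_factmodK scalemx1.
split=> // U1 U2 m1 m2 _ cap.
have [->|n1] := eqVneq U1 0; first by left.
have [->|n2] := eqVneq U2 0; first by right.
have : (E0 <= U1 :&: U2)%MS by rewrite sub_capmx !plane_socle.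
rewrite cap submx0 => /eqP /matrixP /(_ 0 0); rewrite !mxE eqxx => /eqP.
by rewrite oner_eq0.
Qed.
End Plane.

(** A twisted $f$ spans a copy of sign if $cf = f$; otherwise $f$ and $cf - f$ span a copy of the
    indecomposable plane. *)
Lemma twisted_piece m (f : MP) : twisted (2 * m + 1) f -> exists W, sign_triv_subrep m W /\ W f.
Proof.
move=> tf; have qf := twisted_quasi tf; have [sf _ _] := tf.
have [f0|f0] := eqVneq f 0; first by apply: sym_piece; rewrite f0 rpred0.
have [e0|e0] := eqVneq (cyc f - f) 0.
  have hf s : msym s f = (-1) ^+ (s : 'S_3) *: f.
    elim/S3_ind: s.
    - by rewrite sf odd_s12 expr1 scaleN1r.
    - by rewrite -cycE odd_c3 expr0 scale1r; apply/eqP; rewrite -subr_eq0 e0.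
    - by rewrite msym1m odd_perm1 expr0 scale1r.
    - by move=> s t hs ht; rewrite msymMm hs msymZ ht scalerA odd_permM signr_addb.
  by apply: (@line_piece m _ sign1 f f0 _ _ hf qf); [left|].
have /fin_all_exists [lam lamP] := plane_action tf.
exists (fun p => exists v, p = plane_map f v); split; last first.
  by exists (delta_mx 0 1); rewrite /plane_map !mxE /= scale0r scale1r add0r.
split.
  have qe : quasi_invariant m (cyc f - f) by exact: quasi_sym (plane_inv tf).
  by move=> p [v ->]; rewrite /plane_map; exact: quasiD (quasiZ _ qe) (quasiZ _ qf).
exists 2%N, (plane tf e0 lamP); split; first by constructor 3; exact: plane_sign_triv.
exists (plane_map f : {linear _ -> _}); split=> //=; first exact: plane_map_inj tf e0.
by move=> s v; rewrite (plane_equivariant tf lamP).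
Qed.

(** This turns the representation-theoretic definition into linear conditions over the symmetric
    polynomials. *)
Lemma Q_sign_trivP m (p : MP) : Q_sign_triv m p <->
  exists f r, [/\ twisted (2 * m + 1) f, r \is symmetric & p = f + r].
Proof.
split=> [|[f [r [tf sr ->]]]]; first exact: Q_decomp.
exists [:: f; r]; split; first by rewrite big_cons big_seq1.
by move=> w; rewrite !inE => /orP [/eqP ->|/eqP ->]; [exact: twisted_piece|exact: sym_piece].
Qed.

(** * Bases, counterexamples and the classification *)

Lemma twisted_symM n (r f : MP) : r \is symmetric -> twisted n f -> twisted n (r * f).
Proof.
move=> /symmetricP [r1 r2] [sf tr [q hq]]; split.
- by rewrite msymM r1 sf mulrN.
- by rewrite !cycM !r2 -!mulrDr tr mulr0.
- by exists (r * q); rewrite {1}hq mulrA.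
Qed.

Lemma mtwo_neq0 : 2%:R != 0 :> MP.
Proof. by rewrite -mpolyC_nat mpolyC_eq0. Qed.

Lemma odd_2m1 m : odd (2 * m + 1). Proof. by rewrite oddD oddM. Qed.

Lemma anti_dhomog_pos d (f : MP) : f != 0 -> msym s12 f = - f -> f \is d.-homog -> (0 < d)%N.
Proof.
move=> f0 sf hf; rewrite lt0n; apply: contra_neq f0 => d0.
have [->//|f0] := eqVneq f 0.
have := dhomog_msizeE f0 hf; rewrite d0 => /eqP /msize_poly1P [c _ fc].
have sc : msym s12 f = f by rewrite fc -[c%:MP]mulr1 mul_mpolyC msymZ msym1.
apply: (mulfI mtwo_neq0); rewrite mulr0 mulr_natl mulr2n -{1}sc sf addNr //.
Qed.

Section Basis.
Variables (m d1 d2 : nat) (f q : MP).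
Hypotheses (tf : twisted (2 * m + 1) f) (tq : twisted (2 * m + 1) q).
Hypotheses (hf : f \is d1.-homog) (hq : q \is d2.-homog).
Hypotheses (ed : (d1 + d2 = 3 * (2 * m + 1))%N) (w0 : wronsk f q != 0).

Lemma wronsk_neq0l : f != 0.
Proof. by apply: contra_neq w0 => ->; rewrite /wronsk cyc0 mul0r mulr0 subrr. Qed.
Lemma wronsk_neq0r : q != 0.
Proof. by apply: contra_neq w0 => ->; rewrite /wronsk cyc0 mul0r mulr0 subrr. Qed.

Lemma basis_combE (r : nat -> MP) (F : 'I_3 -> MP) : (forall i, F i = r i) ->
  @sym_comb k [:: f; q; 1] F = r 0 * f + r 1 * q + r 2.
Proof.
move=> h; rewrite /sym_comb !big_ord_recl big_ord0 !h /= mulr1 addr0.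
by rewrite addrA.
Qed.

(** Elements $r_0f + r_1q$ are anti-invariant and $r_2$ is invariant under $s_{12}$, so the constant
    $1$ splits off and the wronskian criterion applies to the rest. *)
Lemma basis_free : freely_generates (Q_sign_triv m) [:: f; q; 1].
Proof.
split=> [p|F sF]; first split.
- move=> /Q_sign_trivP [h [r [th sr ->]]].
  have [a [b [sa sb hh]]] := saito (odd_2m1 m) tf tq hf hq ed w0 th.
  pose c := nth 0 [:: a; b; r].
  exists (fun i => c i); split; first by case=> [[|[|[|i]]] hi].
  by rewrite (@basis_combE c _ (fun=> erefl)) //= -hh.
- case=> F [sF ->]; apply/Q_sign_trivP.
  pose r j := if insub j is Some i then F i else 0.
  have rF i : F i = r i by rewrite /r valK.
  have sr j : r j \is symmetric by rewrite /r; case: insubP => *; rewrite ?rpred0.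
  exists (r 0 * f + r 1 * q), (r 2); split=> //; last exact: basis_combE.
  by apply: twistedD; apply: twisted_symM.
pose r j := if insub j is Some i then F i else 0.
have rF i : F i = r i by rewrite /r valK.
have sr j : r j \is symmetric by rewrite /r; case: insubP => *; rewrite ?rpred0.
have s12r j : msym s12 (r j) = r j by case: (symmetricP (r j)).1.
have cr j : cyc (r j) = r j by case: (symmetricP (r j)).1.
rewrite (basis_combE rF) => e0.
have [sf _ _] := tf; have [sq _ _] := tq.
have r20 : r 2 = 0.
  apply: (mulfI mtwo_neq0); rewrite mulr0.
  have := congr1 (msym s12) e0; rewrite !(msymD, msymM) !s12r sf sq msym0 => e1.
  rewrite -[RHS](addr0 0) -{1}e0 -{1}e1; move: (r 0) (r 1) (r 2) => a b c; ring.
have [r00 r10] : r 0 = 0 /\ r 1 = 0.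
  by apply: (wronsk_free w0) => //; rewrite -e0 r20 addr0.
by move=> i; rewrite rF; case: i => [[|[|[|i]]] hi].
Qed.

Lemma basis_minimal g : g \in [:: f; q; 1] -> minimal_generator (Q_sign_triv m) g.
Proof.
apply: free_minimal_generator basis_free _ => h.
rewrite !inE => /or3P [] /eqP ->; eexists; [exact: hf|exact: hq|exact: dhomog1].
Qed.

(** Degrees exclude the two polynomials that do not count as generators. *)
Lemma generator_of g d : g \in [:: f; q] -> g != 0 -> twisted (2 * m + 1) g -> g \is d.-homog ->
  (d < 3 * (2 * m + 1))%N -> generator m g.
Proof.
move=> gin g0 tg hg ld; have [sg _ _] := tg; split=> //.
- by apply: basis_minimal; move: gin; rewrite !inE => /orP [->|->]; rewrite ?orbT.
- move=> g1; have := anti_dhomog_pos g0 sg hg.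
  by rewrite (dhomog_uniq g0 hg (_ : g \is 0.-homog)) // g1 dhomog1.
rewrite diff_prodE => gD.
have hD : g \is (3 * (2 * m + 1)).-homog by rewrite gD dhomogMn // vdm_dhomog.
by move: ld; rewrite (dhomog_uniq g0 hg hD) ltnn.
Qed.

Lemma generator_l : generator m f.
Proof.
have [sq _ _] := tq; have := anti_dhomog_pos wronsk_neq0r sq hq => d20.
apply: (@generator_of _ d1); rewrite ?mem_head ?wronsk_neq0l //.
by rewrite -ed -{1}[d1]addn0 ltn_add2l.
Qed.

Lemma generator_r : generator m q.
Proof.
have [sf _ _] := tf; have := anti_dhomog_pos wronsk_neq0l sf hf => d10.
apply: (@generator_of _ d2); rewrite ?inE ?eqxx ?orbT ?wronsk_neq0r //.
by rewrite -ed -{1}[d2]add0n ltn_add2r.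
Qed.
End Basis.

Lemma frobenius_add (A : comNzRingType) (a b : A) n : 3%:R = 0 :> A ->
  (a + b) ^+ (3 ^ n) = a ^+ (3 ^ n) + b ^+ (3 ^ n).
Proof.
move=> A3; elim: n => [|n IH]; first by rewrite !expr1.
by rewrite expnSr !exprM IH cube_add.
Qed.

(** The Frobenius power preserves trace zero and oddness, and the even power of the Vandermonde
    polynomial is symmetric. *)
Lemma rx_twisted l a b n (P : MP) : twisted (2 * l + 1) P ->
  (n <= 3 ^ a * (2 * l + 1) + 2 * b)%N -> twisted n (P ^+ (3 ^ a) * vdm k ^+ (2 * b)).
Proof.
move=> tP hn; have [sP tr [q hq]] := tP; split.
- rewrite msymM !rmorphXn /= sP s12_vdm exprNn -signr_odd oddX orbT expr1.
  by rewrite exprNn [X in _ * (X * _)]exprM sqrrN expr1n expr1n mul1r mulN1r mulNr.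
- rewrite !cycM !cycXn !cyc_vdm -!mulrDl -!frobenius_add ?mpolyF3_three0 // tr.
  by rewrite expr0n expn_eq0 /= mul0r.
have vE : vdm k = (('X_0 - 'X_i2) * ('X_1 - 'X_i2)) * y12 k.
  by rewrite vdmE /y12 -mulrA mulrC.
set z := 'X_0 - _ in vE; set u := 'X_1 - _ in vE.
exists (q ^+ (3 ^ a) * (z * u) ^+ (2 * b) * y12 k ^+ ((2 * l + 1) * 3 ^ a + 2 * b - n)).
rewrite hq vE [(q * _) ^+ _]exprMn [(z * u * _) ^+ _]exprMn -exprM mulrACA -exprD.
by rewrite -[RHS]mulrA -exprD subnK // mulnC.
Qed.

Lemma rx_dhomog l a b (P : MP) : P \is (3 * l + 1).-homog ->
  P ^+ (3 ^ a) * vdm k ^+ (2 * b) \is (3 ^ a * (3 * l + 1) + 6 * b).-homog.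
Proof.
move=> hP; have := dhomogM (dhomogMn (3 ^ a) hP) (dhomogMn (2 * b) (vdm_dhomog k)).
by rewrite [((3 * l + 1) * _)%N]mulnC mulnA.
Qed.

Lemma rx_neq0 a b (P : MP) : P != 0 -> P ^+ (3 ^ a) * vdm k ^+ (2 * b) != 0.
Proof. by move=> P0; rewrite mulf_neq0 ?expf_neq0 // vdm_neq0. Qed.

(** The shape of a counterexample makes it anti-invariant of trace zero; quasi-invariance adds the
    divisibility. *)
Lemma counterexample_twisted m (F : MP) : ren_xu_counterexample m F ->
  [/\ twisted (2 * m + 1) F, F != 0 & F \is (degree F).-homog].
Proof.
case=> -[a [b [l [P [hP ->]]]]]; rewrite diff_prodE => qF _.
have [tP dP P0] := is_P_twisted hP.
have [s0 t0 _] := @rx_twisted l a b 0 P tP (leq0n _).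
have F0 := rx_neq0 a b P0; have dF := rx_dhomog a b dP.
split=> //; first by split=> //; exact: (anti_quasi_dvd two_neq0 qF s0).
by rewrite /degree (dhomog_msizeE F0 dF).
Qed.

(** The first basis vector has degree either in $\{3m+1, 3m+2\}$ or at most $3m$, and in the second
    case it can be replaced by any lowest counterexample. *)
Theorem theorem5p3 (m : nat) :
  (exists g h : {mpoly 'F_3[3]},
     [/\ generator m g, degree g = (3 * m + 1)%N,
         generator m h, degree h = (3 * m + 2)%N
       & freely_generates (Q_sign_triv m) [:: g; h; 1]])
  \/
  (in_X m /\
   forall Rm : {mpoly 'F_3[3]}, lowest_counterexample m Rm ->
   exists g : {mpoly 'F_3[3]},
     [/\ generator m Rm, generator m g, g <> Rm,
         degree g = (6 * m + 3 - degree Rm)%N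
       & freely_generates (Q_sign_triv m) [:: Rm; g; 1]]).
Proof.
have [F [d1 [d2 [f [q [[pF F0 sF] [tf tq hf hq] w0 ed d12]]]]]] := twisted_basis m.
have degE d (p : MP) : p != 0 -> p \is d.-homog -> degree p = d.
  by move=> p0 hp; rewrite /degree (dhomog_msizeE p0 hp).
have [low|high] := leqP d1 (3 * m).
  right.
  have [|l [a [b [h1 h2]]]] := odd_traceless_descent pF F0; first by rewrite sF addn1.
  have [P hP] := is_P_exists l; have [tP dP P0] := is_P_twisted hP.
  pose C := P ^+ (3 ^ a) * vdm k ^+ (2 * b).
  have hC : ren_xu_counterexample m C.
    split.
    - by exists a, b, l, P; rewrite diff_prodE.
    - exact: twisted_quasi (@rx_twisted l a b _ P tP h1).
    - rewrite (degE _ _ (rx_neq0 a b P0) (rx_dhomog a b dP)).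
      by move: h2; rewrite sF; clear -low; lia.
  split; first by exists C.
  move=> R [hR minR]; have [tR R0 dR] := counterexample_twisted hR.
  have leR : (degree R <= d1)%N.
    apply: leq_trans (minR _ hC) _.
    by rewrite (degE _ _ (rx_neq0 a b P0) (rx_dhomog a b dP)) -ltnS -sF.
  (* Both degrees are at most $3m$, below the bound $6m+3$ for a nonzero wronskian. *)
  have wRf : wronsk R f = 0.
    apply/eqP; apply: contraT => w1.
    have := wronsk_degree (odd_2m1 m) tR tf dR hf w1; clear -leR low; lia.
  have wRq : wronsk R q != 0.
    apply: contra_neq R0 => w1; apply: (mulfI w0); rewrite mulr0.
    have -> : wronsk f q * R = wronsk R q * f - wronsk R f * q by rewrite /wronsk; ring.
    by rewrite w1 wRf !mul0r subrr.
  have geR := wronsk_degree (odd_2m1 m) tR tq dR hq wRq.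
  have eR : degree R = d1 by clear -geR ed leR; lia.
  rewrite eR in dR.
  exists q; split.
  - exact: generator_l tR tq dR hq ed wRq.
  - exact: generator_r tR tq dR hq ed wRq.
  - move=> qR; move: wRq; rewrite qR /wronsk subrr eqxx //.
  - rewrite (degE d2) ?eR //; first by clear -ed; lia.
    exact: wronsk_neq0r w0.
  - exact: basis_free tR tq dR hq ed wRq.
left; have f0 := wronsk_neq0l w0; have q0 := wronsk_neq0r w0.
have [e1|e1] : d1 = (3 * m + 1)%N \/ d1 = (3 * m + 2)%N by clear -high d12 ed; lia.
  exists f, q; split.
  - exact: generator_l tf tq hf hq ed w0.
  - by rewrite (degE d1).
  - exact: generator_r tf tq hf hq ed w0.
  - by rewrite (degE d2) //; clear -ed e1; lia.
  - exact: basis_free tf tq hf hq ed w0.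
have w0' : wronsk q f != 0.
  by have -> : wronsk q f = - wronsk f q by [rewrite /wronsk; ring]; rewrite oppr_eq0.
have ed' : (d2 + d1 = 3 * (2 * m + 1))%N by rewrite addnC.
exists q, f; split.
- exact: generator_l tq tf hq hf ed' w0'.
- by rewrite (degE d2) //; clear -ed e1; lia.
- exact: generator_r tq tf hq hf ed' w0'.
- by rewrite (degE d1).
- exact: basis_free tq tf hq hf ed' w0'.
Qed.
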